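(* Let $(M,g)$ be a complete $n$-dimensional smooth Riemannian manifold with $\mathrm{Ric}\ge (n-1)K>0$ and let $\Omega$ be a bounded domain in $M$ with $C^1$ boundary. Then $$\mu_j\ge\left(\eta_1+(n-1)K\right)m_j$$ for all $j\in\mathbb N$, where $\mu_j$ are the biharmonic Neumann eigenvalues, $m_j$ the Neumann eigenvalues of the Laplacian, and $\eta_1$ the first Neumann eigenvalue of the rough Laplacian on $1$-forms on $\Omega$.
   Context: A domain is a connected open set; $\mathbb N$ is the set of positive integers; $\mathrm{Ric}\geq (n-1)K$ means $\mathrm{Ric}(X,X)\ge (n-1)K\langle X,X\rangle$ for all tangent vectors $X$. $dv$ is the Riemannian volume element; $\nabla$, $D^2$ are the gradient (or covariant derivative, on forms) and the Hessian. $H^2(\Omega)$ is the completion of $C^\infty(\Omega)$ (functions with finite norm) with respect to $\left(\int_\Omega(|D^2f|^2+|\nabla f|^2+f^2)dv\right)^{1/2}$; $H^1(\Omega)$ is defined similarly with $\left(\int_\Omega(|\nabla f|^2+f^2)dv\right)^{1/2}$; $\mathcal H^1(\Omega)$ is the space of $1$-forms on $\Omega$ of class $H^1$. The biharmonic Neumann eigenvalues $\mu_1\le\mu_2\le\cdots$ (repeated with multiplicity) are those of $\int_\Omega(\langle D^2u,D^2\phi\rangle+\mathrm{Ric}(\nabla u,\nabla\phi))dv=\mu\int_\Omega u\phi\,dv$ for all $\phi\in H^2(\Omega)$, $u\in H^2(\Omega)$, that is $$\mu_j=\min_{\substack{U\subset H^2(\Omega)\\ \dim U=j}}\max_{0\ne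 u\in U}\frac{\int_\Omega(|D^2u|^2+\mathrm{Ric}(\nabla u,\nabla u))dv}{\int_\Omega u^2dv}.$$ Moreover $$m_j=\min_{\substack{U\subset H^1(\Omega)\\ \dim U=j}}\max_{0\ne u\in U}\frac{\int_\Omega|\nabla u|^2dv}{\int_\Omega u^2dv},\qquad \eta_j=\min_{\substack{\mathcal W\subset\mathcal H^1(\Omega)\\ \dim\mathcal W=j}}\max_{0\ne\omega\in\mathcal W}\frac{\int_\Omega|\nabla\omega|^2dv}{\int_\Omega|\omega|^2dv}.$$ *)

(* Defs.v *)
From HB Require Import structures.
From mathcomp Require Import all_boot all_order all_algebra.
From mathcomp Require Import all_classical all_reals all_analysis.

Set Implicit Arguments.
Unset Strict Implicit.
Unset Printing Implicit Defensive.

Import Order.TTheory GRing.Theory Num.Theory numFieldNormedType.Exports.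

Local Open Scope classical_set_scope.
Local Open Scope ring_scope.

Definition partial {R : realType} {n : nat} (a : 'I_n) (f : 'rV[R]_n -> R)
  (x : 'rV[R]_n) : R := 'D_(delta_mx ord0 a) f x.

(* [A] is meant to be open *)
Fixpoint Ck {R : realType} {n : nat} (k : nat) (A : set 'rV[R]_n)
    (f : 'rV[R]_n -> R) : Prop :=
  (forall x, A x -> {for x, continuous f}) /\
  if k is k'.+1 then
    forall a : 'I_n, (forall x, A x -> derivable f x (delta_mx ord0 a)) /\
                     Ck k' A (partial a f)
  else True.

Definition smooth_on {R : realType} {n : nat} (A : set 'rV[R]_n)
  (f : 'rV[R]_n -> R) : Prop := forall k, Ck k A f.

(* Lebesgue integral over R^n of a nonnegative Borel function, as an iterated
   integral (Tonelli) *)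
Fixpoint integral_rV {R : realType} (n : nat) :
    ('rV[R]_n -> \bar R) -> \bar R :=
  match n with
  | 0 => fun f => f 0
  | n'.+1 => fun f =>
      (\int[lebesgue_measure]_t
         integral_rV (fun x : 'rV[R]_n' => f (row_mx (t%:M : 'M[R]_1) x)))%E
  end.

(* A second countable Hausdorff space with a smooth atlas, not necessarily
   maximal, and a smooth metric given by its matrices in the charts.
   Coordinates of points and of tangent vectors are rows, components of
   covectors are columns.  As ['J f x] acts on rows from the right, tangent
   vectors transform by [v_j = v_i *m J], covectors by [w_i = J *m w_j].
   [chart_inv i] inverts [chart_coord i] on [chart_dom i]; all values outside of the
   domains are irrelevant. *)
Record riemannian (R : realType) (n : nat) (M : ptopologicalType) := Riemannian {
  chart : Type;
  chart_dom : chart -> set M;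
  chart_coord : chart -> M -> 'rV[R]_n;
  chart_inv : chart -> 'rV[R]_n -> M;
  chart_at : M -> chart;
  metric : chart -> M -> 'M[R]_n;
  manifold_hausdorff : hausdorff_space M;
  manifold_second_countable : @second_countable M;
  dom_chart_at : forall p, chart_dom (chart_at p) p;
  dom_open : forall i, open (chart_dom i);
  codom_open : forall i, open (chart_coord i @` chart_dom i);
  coordK : forall i p, chart_dom i p -> chart_inv i (chart_coord i p) = p;
  coord_continuous : forall i p, chart_dom i p -> {for p, continuous (chart_coord i)};
  coord_inv_continuous : forall i x, (chart_coord i @` chart_dom i) x ->
    {for x, continuous (chart_inv i)};
  transition_smooth : forall i j a,
    smooth_on (chart_coord i @` (chart_dom i `&` chart_dom j))
      (fun x => chart_coord j (chart_inv i x) ord0 a);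
  metric_sym : forall i p, chart_dom i p -> (metric i p)^T = metric i p;
  metric_pos : forall i p, chart_dom i p -> forall v : 'rV[R]_n, v != 0 ->
    0 < (v *m metric i p *m v^T) ord0 ord0;
  metric_compat : forall i j p, chart_dom i p -> chart_dom j p ->
    metric i p = 'J (chart_coord j \o chart_inv i) (chart_coord i p) *m metric j p
                   *m ('J (chart_coord j \o chart_inv i) (chart_coord i p))^T;
  metric_smooth : forall i a b,
    smooth_on (chart_coord i @` chart_dom i) (fun x => metric i (chart_inv i x) a b)
}.

Definition borel (M : ptopologicalType) := g_sigma_algebraType (@open M).

Section tensors.
Variables (R : realType) (n : nat) (M : ptopologicalType) (g : riemannian R n M).

(* 1-forms and 2-covariant tensor fields, by their components in every chart *)
Definition field1 := chart g -> M -> 'cV[R]_n.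
Definition field2 := chart g -> M -> 'M[R]_n.

Definition transition_jacobian (i j : chart g) (p : M) : 'M[R]_n :=
  'J (chart_coord j \o chart_inv i) (chart_coord i p).

Definition is_form (Omega : set M) (w : field1) : Prop :=
  forall i j p, Omega p -> chart_dom i p -> chart_dom j p ->
    w i p = transition_jacobian i j p *m w j p.

Definition is_tensor2 (Omega : set M) (T : field2) : Prop :=
  forall i j p, Omega p -> chart_dom i p -> chart_dom j p ->
    T i p = transition_jacobian i j p *m T j p *m (transition_jacobian i j p)^T.

Definition smooth_fun (Omega : set M) (f : M -> R) : Prop :=
  forall i, smooth_on (chart_coord i @` (chart_dom (r := g) i `&` Omega)) (f \o chart_inv i).

Definition smooth_form (Omega : set M) (w : field1) : Prop :=
  is_form Omega w /\
  forall i a, smooth_on (chart_coord i @` (chart_dom i `&` Omega))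
                (fun x => w i (chart_inv i x) a ord0).

Definition measurable_form (Omega : set M) (w : field1) : Prop :=
  forall i a, measurable_fun ((chart_dom i `&` Omega) : set (borel M))
                (fun p : borel M => w i p a ord0).

Definition measurable_tensor2 (Omega : set M) (T : field2) : Prop :=
  forall i a b, measurable_fun ((chart_dom i `&` Omega) : set (borel M))
                  (fun p : borel M => T i p a b).

Definition norm_sq (i : chart g) (p : M) (v : 'rV[R]_n) : R :=
  (v *m metric i p *m v^T) ord0 ord0.

Definition sharp (i : chart g) (p : M) (w : 'cV[R]_n) : 'rV[R]_n :=
  (invmx (metric i p) *m w)^T.

Definition form_norm_sq (w : field1) (p : M) : R :=
  let i := chart_at g p in norm_sq i p (sharp i p (w i p)).

Definition tensor2_norm_sq (T : field2) (p : M) : R :=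
  let i := chart_at g p in
  \tr (invmx (metric i p) *m T i p *m invmx (metric i p) *m (T i p)^T).

(* [christoffel i c a b] is \Gamma^c_{ab} as a function of the coordinates *)
Definition christoffel (i : chart g) (c a b : 'I_n) (x : 'rV[R]_n) : R :=
  let G x := metric i (chart_inv i x) in
  2^-1 * \sum_(d < n) invmx (G x) c d *
    (partial a (fun y => G y b d) x + partial b (fun y => G y a d) x
     - partial d (fun y => G y a b) x).

(* R(\partial_a, \partial_b) \partial_c = \sum_d curvature i d c a b \partial_d,
   with R(X, Y) = [\nabla_X, \nabla_Y] - \nabla_[X, Y] *)
Definition curvature (i : chart g) (d c a b : 'I_n) (x : 'rV[R]_n) : R :=
  partial a (christoffel i d b c) x - partial b (christoffel i d a c) x
  + \sum_(e < n) (christoffel i d a e x * christoffel i e b c x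
                  - christoffel i d b e x * christoffel i e a c x).

(* Ric(Y, Z) = tr (X |-> R(X, Y) Z) *)
Definition ricci (i : chart g) (p : M) : 'M[R]_n :=
  \matrix_(b, c) \sum_(a < n) curvature i a c a b (chart_coord i p).

Definition ricci_ge (k : R) : Prop :=
  forall (i : chart g) p, chart_dom i p -> forall v : 'rV[R]_n,
    k * norm_sq i p v <= (v *m ricci i p *m v^T) ord0 ord0.

(* Ric(w^\sharp, w^\sharp), that is, Ric(\nabla u, \nabla u) for w = du *)
Definition ricci_sharp (w : field1) (p : M) : R :=
  let i := chart_at g p in
  let v := sharp i p (w i p) in (v *m ricci i p *m v^T) ord0 ord0.

Definition differential (f : M -> R) : field1 :=
  fun i p => \col_a partial a (f \o chart_inv i) (chart_coord i p).

Definition covariant_derivative (w : field1) : field2 :=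
  fun i p => \matrix_(a, b)
    (partial a (fun x => w i (chart_inv i x) b ord0) (chart_coord i p)
     - \sum_(c < n) christoffel i c a b (chart_coord i p) * w i p c ord0).

Definition hessian (f : M -> R) : field2 := covariant_derivative (differential f).

End tensors.

Arguments differential {R n M} g f i p.
Arguments hessian {R n M} g f i p.

Section distance.
Variables (R : realType) (n : nat) (M : ptopologicalType) (g : riemannian R n M).

Definition C1_curve (c : R -> M) : Prop :=
  continuous c /\
  forall (i : chart g) t, chart_dom i (c t) ->
    derivable (chart_coord i \o c) t 1 /\ {for t, continuous (derive1 (chart_coord i \o c))}.

Definition speed (c : R -> M) (t : R) : R :=
  let i := chart_at g (c t) in
  Num.sqrt (norm_sq i (c t) (derive1 (chart_coord i \o c) t)).

Definition curve_length (c : R -> M) : \bar R :=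
  (\int[lebesgue_measure]_(t in `[0%R, 1%R]) (speed c t)%:E)%E.

(* Curves are not required to be regular, so that a piecewise C^1 curve becomes
   C^1 (with a C^1 extension to R) by slowing down at its corners and ends. *)
Definition distance (p q : M) : \bar R :=
  ereal_inf [set curve_length c | c in
    [set c | C1_curve c /\ c 0 = p /\ c 1 = q]].

Definition riemannian_complete : Prop :=
  forall u : nat -> M,
    (forall e : R, 0 < e -> exists N : nat, forall k l : nat,
       (N <= k)%N -> (N <= l)%N -> (distance (u k) (u l) < e%:E)%E) ->
    exists p : M, u @ \oo --> p.

Definition riemannian_bounded (Omega : set M) : Prop :=
  exists (p : M) (r : R), forall q, Omega q -> (distance p q < r%:E)%E.

Definition C1_boundary (Omega : set M) : Prop :=
  forall p, (closure Omega `\` interior Omega) p ->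
  exists (i : chart g) (W : set 'rV[R]_n) (h : 'rV[R]_n -> R),
    [/\ chart_dom i p, open W, W `<=` chart_coord i @` chart_dom i & W (chart_coord i p)] /\
    [/\ Ck 1 W h,
        forall x, W x -> exists a, partial a h x != 0 &
        forall x, W x -> (Omega (chart_inv i x) <-> h x < 0)].

(* the volume element is \sqrt (det g) dx in every chart; this determines the
   Borel measure [dv] *)
Definition is_riemannian_volume (dv : {measure set (borel M) -> \bar R}) : Prop :=
  forall (i : chart g) (A : set (borel M)), measurable A -> A `<=` chart_dom i ->
    dv A = integral_rV (fun x : 'rV[R]_n =>
      ((\1_(chart_coord i @` A) x : R) *
       Num.sqrt (\det (metric i (chart_inv i x))))%:E).

End distance.

(* Min-max values: E is a space of representatives, [nsq] its squared norm,
   whose null vectors are identified with 0.  A subspace U of dimension [j] is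
   the span of [b], independent modulo null vectors; 0 is excluded from the
   maximum. *)
Definition minmax (R : realType) (V : lmodType R) (E : set V)
    (nsq num den : V -> \bar R) (j : nat) : \bar R :=
  ereal_inf
    [set ereal_sup
       [set (num u / den u)%E | u in
         [set u | (exists c : 'I_j -> R, u = \sum_i c i *: b i) /\ nsq u <> 0%E]]
    | b in [set b : 'I_j -> V |
        (forall i, E (b i)) /\
        (forall c : 'I_j -> R, nsq (\sum_i c i *: b i) = 0%E ->
           forall i, c i = 0)]].

(* The completions are realized inside the L^2 spaces: an element of H^2 is
   (u, \nabla u, D^2 u), the L^2 limit of the triples (f, df, D^2 f) of smooth
   functions f of finite norm, and similarly for H^1. *)
Section eigenvalues.
Variables (R : realType) (n : nat) (M : ptopologicalType) (g : riemannian R n M).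
Variables (dv : {measure set (borel M) -> \bar R}) (Omega : set M).

Definition H1_space : lmodType R := ((M -> R^o) * field1 g)%type.
Definition H2_space : lmodType R := ((M -> R^o) * field1 g * field2 g)%type.
Definition H1form_space : lmodType R := (field1 g * field2 g)%type.

Definition integral_Omega (F : M -> R) : \bar R :=
  (\int[dv]_(p in (Omega : set (borel M))) (F p)%:E)%E.

Definition H1_norm_sq (u : H1_space) : \bar R :=
  integral_Omega (fun p => form_norm_sq u.2 p + (u.1 p) ^+ 2).

Definition H2_norm_sq (u : H2_space) : \bar R :=
  integral_Omega (fun p =>
    tensor2_norm_sq u.2 p + form_norm_sq u.1.2 p + (u.1.1 p) ^+ 2).

Definition H1form_norm_sq (w : H1form_space) : \bar R :=
  integral_Omega (fun p => tensor2_norm_sq w.2 p + form_norm_sq w.1 p).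

Definition H1_jet (f : M -> R) : H1_space := (f, differential g f).
Definition H2_jet (f : M -> R) : H2_space := (f, differential g f, hessian g f).
Definition H1form_jet (w : field1 g) : H1form_space := (w, covariant_derivative w).

Definition sobolev_H1 : set H1_space := [set u |
  [/\ measurable_fun (Omega : set (borel M)) (u.1 : borel M -> R),
      is_form Omega u.2 & measurable_form Omega u.2] /\
  exists f : nat -> M -> R,
    (forall k, smooth_fun g Omega (f k) /\ (H1_norm_sq (H1_jet (f k)) < +oo)%E) /\
    H1_norm_sq (H1_jet (f k) - u) @[k --> \oo] --> 0%E].

Definition sobolev_H2 : set H2_space := [set u |
  [/\ measurable_fun (Omega : set (borel M)) (u.1.1 : borel M -> R),
      is_form Omega u.1.2, measurable_form Omega u.1.2,
      is_tensor2 Omega u.2 & measurable_tensor2 Omega u.2] /\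
  exists f : nat -> M -> R,
    (forall k, smooth_fun g Omega (f k) /\ (H2_norm_sq (H2_jet (f k)) < +oo)%E) /\
    H2_norm_sq (H2_jet (f k) - u) @[k --> \oo] --> 0%E].

Definition sobolev_H1form : set H1form_space := [set w |
  [/\ is_form Omega w.1, measurable_form Omega w.1,
      is_tensor2 Omega w.2 & measurable_tensor2 Omega w.2] /\
  exists f : nat -> field1 g,
    (forall k, smooth_form Omega (f k) /\
               (H1form_norm_sq (H1form_jet (f k)) < +oo)%E) /\
    H1form_norm_sq (H1form_jet (f k) - w) @[k --> \oo] --> 0%E].

(* \mu_j, m_j and \eta_j, for j >= 1 *)
Definition biharmonic_neumann_eigenvalue (j : nat) : \bar R :=
  minmax sobolev_H2 H2_norm_sq
    (fun u => integral_Omega (fun p =>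
       tensor2_norm_sq u.2 p + ricci_sharp u.1.2 p))
    (fun u => integral_Omega (fun p => (u.1.1 p) ^+ 2)) j.

Definition neumann_eigenvalue (j : nat) : \bar R :=
  minmax sobolev_H1 H1_norm_sq
    (fun u => integral_Omega (fun p => form_norm_sq u.2 p))
    (fun u => integral_Omega (fun p => (u.1 p) ^+ 2)) j.

Definition rough_neumann_eigenvalue (j : nat) : \bar R :=
  minmax sobolev_H1form H1form_norm_sq
    (fun w => integral_Omega (fun p => tensor2_norm_sq w.2 p))
    (fun w => integral_Omega (fun p => form_norm_sq w.1 p)) j.

End eigenvalues.

(* Main.v *)
Require Import Defs.
From HB Require Import structures.
From mathcomp Require Import all_boot all_order all_algebra.
From mathcomp Require Import all_classical all_reals all_analysis.
From mathcomp Require Import measurable_realfun.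
From mathcomp Require Import ring lra.
Import Order.TTheory GRing.Theory Num.Theory numFieldNormedType.Exports.
Local Open Scope classical_set_scope.
Local Open Scope ring_scope.

Set Implicit Arguments.
Unset Strict Implicit.

(** The inequality is pointwise in the trial space.  Let [U] be a [j]-dimensional
    space of triples [(u, du, D^2 u)] in [H^2(Omega)].  For [u] in [U] the form
    [du], together with its covariant derivative [D^2 u], is a competitor for
    [eta_1], so that
      [eta_1 * int |du|^2 <= int |D^2 u|^2],
    while the Ricci bound gives [(n-1) K * int |du|^2 <= int Ric (du, du)].
    Adding the two ([energy_ge_rough]) and dividing by [int u^2], the biharmonic
    quotient of [u] is at least [eta_1 + (n-1) K] times its Dirichlet quotient;
    as [U] is also a trial space for [m_j], taking the maximum over [U] and then
    the infimum over [U] gives the theorem ([biharmonic_ge]).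

    Two points need care.  First, forgetting the second derivatives might lower
    the dimension of [U].  This happens only if some nonnull triple of [U] has a
    vanishing function component; its energy is then positive and its
    denominator zero, so that the maximum over [U] is infinite
    ([quotient_infinite]) and there is nothing to prove.

    Second, [U] must consist of elements of [H^2(Omega)], that is, [H^2(Omega)]
    must be closed under linear combinations ([sobolev_H2_lin]).  The norms
    |D^2 f - T|^2 have to be integrated, hence measurable, although at each point
    they are computed in an arbitrarily chosen chart.  They are measurable
    because they do not depend on the chart, i.e. because the Hessian is a tensor
    ([covariant_derivative_tensor]).  That rests on the transformation law of
    the Christoffel symbols ([koszul_change]), which in turn uses the symmetry of
    second derivatives ([partialC]) and the chain rule for maps with continuous
    partial derivatives ([C1_differentiable], [partial_comp]). *)

(** * Calculus in several variables *)

Lemma derivable_line {R : realType} {n : nat} (f : 'rV[R]_n -> R)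
    (y v : 'rV[R]_n) (t : R) :
  derivable f (t *: v + y) v ->
  is_derive t 1 (fun s => f (s *: v + y)) ('D_v f (t *: v + y)).
Proof.
have E : (fun h : R => h^-1 *: (((fun s => f (s *: v + y)) \o shift t) (h *: 1)
             - f (t *: v + y)))
    = (fun h => h^-1 *: ((f \o shift (t *: v + y)) (h *: v) - f (t *: v + y))).
  by apply/funext => h /=; rewrite addrA -scalerDl [h *: 1]mulr1.
by move=> df; apply: DeriveDef; rewrite /derivable /derive E.
Qed.

(** The bound on the parameter is on [`|t|], so that increments [s] of either
    sign are covered. *)
Lemma MVT_line {R : realType} {n : nat} (f : 'rV[R]_n -> R)
    (y v : 'rV[R]_n) (s : R) :
  (forall t : R, `|t| <= `|s| -> derivable f (t *: v + y) v) ->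
  exists2 c, `|c| <= `|s| &
    f (s *: v + y) - f y = s * 'D_v f (c *: v + y).
Proof.
move=> df; pose g t := f (t *: v + y); pose dg t := 'D_v f (t *: v + y).
have dg' (t : R) : `|t| <= `|s| -> is_derive t (1 : R) g (dg t).
  by move=> /df; apply: derivable_line.
have gc (a b : R) : (forall t, t \in `[a, b] -> `|t| <= `|s|) ->
    {within `[a, b], continuous g}.
  move=> ab; apply: derivable_within_continuous => t /ab /dg' [].
  by [].
have f0 : f y = g 0 by rewrite /g scale0r add0r.
have [s0|s0] := leP 0 s.
  have itv t : t \in `[0, s] -> `|t| <= `|s|.
    by rewrite in_itv/= => /andP[t0 ts]; rewrite !ger0_norm.
  have [c cI E] : exists2 c, c \in `[0, s] & g s - g 0 = dg c * (s - 0).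
    apply: MVT_segment; [exact: s0| |exact: gc].
    by move=> x xI; apply/dg'/itv; apply: subset_itv_oo_cc xI.
  by exists c; [exact: itv | rewrite f0 -/(g s) E subr0 mulrC].
have itv t : t \in `[s, 0] -> `|t| <= `|s|.
  by rewrite in_itv/= => /andP[st t0]; rewrite (ler0_norm t0) (ler0_norm (ltW s0)) lerN2.
have [c cI E] : exists2 c, c \in `[s, 0] & g 0 - g s = dg c * (0 - s).
  apply: MVT_segment; [exact: ltW| |exact: gc].
  by move=> x xI; apply/dg'/itv; apply: subset_itv_oo_cc xI.
exists c; first exact: itv.
by rewrite f0 -/(g s) -opprB E sub0r mulrN opprK mulrC.
Qed.

(** The mean value theorem is applied twice: in the direction [u] to
    [y |-> f (s v + y) - f y], then in the direction [v] to ['D_u f].  The left-hand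
    side is symmetric in [u] and [v]. *)
Lemma second_difference {R : realType} {n : nat} (f : 'rV[R]_n -> R)
    (x u v : 'rV[R]_n) (s : R) :
  (forall t t' : R, `|t| <= `|s| -> `|t'| <= `|s| ->
     derivable f (t *: u + t' *: v + x) u /\
     derivable ('D_u f) (t *: u + t' *: v + x) v) ->
  exists c c', [/\ `|c| <= `|s|, `|c'| <= `|s| &
    f (s *: u + s *: v + x) - f (s *: u + x) - f (s *: v + x) + f x =
      s * s * 'D_v ('D_u f) (c *: u + c' *: v + x)].
Proof.
move=> df.
pose g y := f (s *: v + y) - f y.
have P (p q r : 'rV[R]_n) : p + (q + r) = q + p + r by rewrite addrCA addrA.
have s0 : `|0 : R| <= `|s| by rewrite normr0.
have Q (t : R) : (fun h : R => h^-1 *: ((f \o shift (t *: u + s *: v + x)) (h *: u)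
      - f (t *: u + s *: v + x))) =
    (fun h => h^-1 *: (((fun y => f (s *: v + y)) \o shift (t *: u + x)) (h *: u)
      - f (s *: v + (t *: u + x)))).
  apply/funext => h /=; congr (_ *: (f _ - f _)).
    by rewrite (addrCA (s *: v)); congr (_ + _); rewrite -P.
  by rewrite -P.
have dgs t : `|t| <= `|s| -> derivable (fun y => f (s *: v + y)) (t *: u + x) u.
  by move=> ts; have [+ _] := df _ _ ts (lexx _); rewrite /derivable Q.
have Dgs t : 'D_u (fun y => f (s *: v + y)) (t *: u + x) =
    'D_u f (t *: u + s *: v + x).
  by rewrite /derive -Q.
have dft t : `|t| <= `|s| -> derivable f (t *: u + x) u.
  by move=> ts; have [+ _] := df _ _ ts s0; rewrite scale0r addr0.
have [|c cs Ec] := @MVT_line R n g x u s.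
  by move=> t ts; apply: derivableB; [exact: dgs|exact: dft].
have [|c' c's Ec'] := @MVT_line R n ('D_u f) (c *: u + x) v s.
  by move=> t ts; have [_ +] := df _ _ cs ts; rewrite P.
exists c, c'; split; [exact: cs|exact: c's|].
have -> : f (s *: u + s *: v + x) - f (s *: u + x) - f (s *: v + x) + f x =
    g (s *: u + x) - g x.
  by rewrite /g P opprB addrA addrAC.
rewrite Ec deriveB; [|exact: dgs|exact: dft].
rewrite Dgs; have -> : c *: u + s *: v + x = s *: v + (c *: u + x).
  by rewrite P.
rewrite Ec' (P (c' *: v)).
rewrite mulrA.
reflexivity.
Qed.

Lemma norm_delta_mx_le1 {R : realType} {n : nat} (a : 'I_n) :
  `|delta_mx ord0 a : 'rV[R]_n| <= 1.
Proof.
rewrite /Num.norm/= mx_normrE; apply: bigmax_le => // -[i j] _.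
by rewrite mxE/=; case: (_ && _); rewrite ?normr1 ?normr0.
Qed.

Lemma norm_entry_le {R : realType} {n : nat} (h : 'rV[R]_n) a :
  `|h ord0 a| <= `|h|.
Proof.
rewrite [leRHS]/Num.norm/= mx_normrE.
exact: (le_bigmax _ (fun ij => `|h ij.1 ij.2|) (ord0, a)).
Qed.

(** The second difference of [f] in two coordinate directions does not depend on
    their order.  Divided by [s^2] it is a value of either mixed derivative close
    to [x], and both mixed derivatives are continuous at [x]. *)
Lemma partialC {R : realType} {n : nat} (A : set 'rV[R]_n) f x (a b : 'I_n) :
  open A -> Ck 2 A f -> A x ->
  partial a (partial b f) x = partial b (partial a f) x.
Proof.
move=> oA Cf Ax.
have cD a' b' : {for x, continuous (partial a' (partial b' f))}.
  by have [_ /(_ b')[_ [_ /(_ a')[_ [+ _]]]]] := Cf; apply.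
have dA : forall a', (forall y, A y -> derivable f y (delta_mx ord0 a')) /\
    forall b' y, A y -> derivable (partial a' f) y (delta_mx ord0 b').
  move=> a'; have [_ /(_ a')[d1 [_ d2]]] := Cf; split; first exact: d1.
  by move=> b' y Ay; have [db _] := d2 b'; exact: db.
apply/eqP; rewrite -subr_eq0 -normr_le0; apply/ler_addgt0Pr => e e0.
rewrite add0r.
have e2 : 0 < e / 2 by rewrite divr_gt0.
pose nearD c d := [set y | `|partial c (partial d f) x - partial c (partial d f) y| <= e / 2].
have nD c d : nbhs x (nearD c d) by have /cvgrPdist_le/(_ _ e2) := cD c d.
have nA : nbhs x (A `&` (nearD a b `&` nearD b a)).
  by apply: filterI; [exact: open_nbhs_nbhs | apply: filterI; exact: nD].
have /nbhs_ballP[r /= r0 rA] := nA.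
(* two steps of length [s] must not leave the ball of radius [r] *)
pose s := r / 3; have s0 : 0 < s by rewrite divr_gt0.
have inA a' b' t t' : `|t| <= `|s| -> `|t'| <= `|s| ->
    ball x r (t *: delta_mx ord0 a' + t' *: delta_mx ord0 b' + x).
  move=> ts t's; rewrite -ball_normE /= opprD addrCA subrr addr0 normrN.
  apply: le_lt_trans (ler_normD _ _) _; rewrite !normrZ.
  apply: (@le_lt_trans _ _ (`|t| + `|t'|)).
    by apply: lerD; apply: ler_piMr => //; exact: norm_delta_mx_le1.
  apply: (le_lt_trans (lerD ts t's)); rewrite gtr0_norm// /s.
  by move: r0; clear; move=> ?; lra.
have [|c [c' [cs c's E1]]] := @second_difference R n f x
    (delta_mx ord0 a) (delta_mx ord0 b) s.
  by move=> t t' ts t's; have [Ay _] := rA _ (inA a b _ _ ts t's);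
    have [d1 d2] := dA a; split; [exact: d1 | exact: d2].
have [|d [d' [ds d's E2]]] := @second_difference R n f x
    (delta_mx ord0 b) (delta_mx ord0 a) s.
  by move=> t t' ts t's; have [Ay _] := rA _ (inA b a _ _ ts t's);
    have [d1 d2] := dA b; split; [exact: d1 | exact: d2].
have [_ [_ H1]] := rA _ (inA a b _ _ cs c's).
have [_ [H2 _]] := rA _ (inA b a _ _ ds d's).
have E : partial b (partial a f) (c *: delta_mx ord0 a + c' *: delta_mx ord0 b + x)
  = partial a (partial b f) (d *: delta_mx ord0 b + d' *: delta_mx ord0 a + x).
  apply: (@mulfI _ (s * s)); first by rewrite mulf_neq0 ?gt_eqF.
  rewrite -[LHS]E1 -[RHS]E2 (addrC (s *: delta_mx ord0 a) (s *: delta_mx ord0 b)).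
  by congr (_ + _); exact: addrAC.
move: H1 H2; rewrite /nearD /= E.
move: (partial a (partial b f) x) (partial b (partial a f) x)
  (partial a (partial b f) _) => p q w; clear; rewrite !ler_norml; lra.
Qed.

Lemma row_sum_entries {R : realType} {n : nat} (h : 'rV[R]_n) :
  h = \sum_(a < n) h ord0 a *: delta_mx ord0 a.
Proof. exact: row_sum_delta. Qed.

Lemma continuous_entry_mul {R : realType} {n : nat} (a : 'I_n) (p : R) :
  continuous (fun h : 'rV[R]_n => h ord0 a * p).
Proof.
move=> x; apply: differentiable_continuous.
apply: (@differentiableM _ _ (fun h : 'rV[R]_n => h ord0 a) (cst p)).
  exact: differentiable_coord.
exact: differentiable_cst.
Qed.

Lemma linear_of_coefficients {R : realType} {n : nat} (p : 'I_n -> R) :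
  exists2 df : {linear 'rV[R]_n -> R}, continuous df &
    forall h, df h = \sum_(a < n) h ord0 a * p a.
Proof.
have lin : linear (fun h : 'rV[R]_n => \sum_(a < n) h ord0 a * p a : R).
  move=> c u v; rewrite scaler_sumr -big_split/=; apply: eq_bigr => a _.
  by rewrite !mxE mulrDl -mulrA.
pose H := GRing.isLinear.Build R 'rV[R]_n R *:%R
  (fun h : 'rV[R]_n => \sum_(a < n) h ord0 a * p a : R) lin.
pose df : {linear 'rV[R]_n -> R} := HB.pack (fun h : 'rV[R]_n => \sum_(a < n) h ord0 a * p a : R) H.
exists df => //.
rewrite (_ : (df : _ -> _) = \sum_(a < n) (fun h : 'rV[R]_n => h ord0 a * p a)); last first.
  by apply/funext => h; rewrite fct_sumE.
elim/big_ind : _ => [|f g cf cg|a _] x.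
- exact: cst_continuous.
- exact: (continuousD (cf x) (cg x)).
- exact: (@continuous_entry_mul R n a (p a) x).
Qed.

(** The differential is a choice among the linear maps that fit the first order
    expansion, so exhibiting one of them is enough. *)
Lemma differentiable_of_expansion {R : numFieldType} {V W : normedModType R}
    (f : V -> W) (df : {linear V -> W}) x :
  continuous df -> f \o shift x = cst (f x) + df +o_ 0 id -> differentiable f x.
Proof.
move=> dfc H; apply/diff_locallyP; have E := diff_unique dfc H.
by split; rewrite E.
Qed.

(** From [x] to [x + h] one coordinate is changed at a time.  By the mean value
    theorem the [k]-th step contributes [h_k] times a value of the [k]-th partial
    derivative near [x], which continuity lets replace by its value at [x]. *)
Lemma C1_differentiable {R : realType} {n : nat} (A : set 'rV[R]_n) f x :
  open A -> Ck 1 A f -> A x -> differentiable f x.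
Proof.
move=> oA Cf Ax.
have [df dfc dfE] := @linear_of_coefficients R n (fun a => partial a f x).
have := @differentiable_of_expansion R 'rV[R]_n R f df x dfc; apply; apply/eqaddoP => _/posnumP[e].
(* each of the [n] steps may cost [e' * `|h|]; the successor avoids dividing by 0 for [n = 0] *)
pose e' : R := e%:num / n.+1%:R.
have e'0 : 0 < e' by rewrite divr_gt0.
have nC : nbhs x (A `&` [set y | forall a, `|partial a f x - partial a f y| <= e']).
  apply: filterI; first exact: open_nbhs_nbhs.
  pose P a y := `|partial a f x - partial a f y| <= e'.
  apply: (@filter_forall _ _ P (nbhs x) _) => a; rewrite /P.
  have [_ /(_ a)[_ [/(_ x Ax) c _]]] := Cf.
  by have /cvgrPdist_le/(_ _ e'0) := c.
have /nbhs_ballP[r /= r0 rA] := nC.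
apply/nbhs_ballP; exists r => // h /=.
rewrite -ball_normE /= sub0r normrN => hr.
rewrite !fctE dfE /=.
(* [x + hk k] is the point reached after the first [k] coordinates have moved *)
pose hk k : 'rV[R]_n := \row_(a < n) (if (a < k)%N then h ord0 a else 0).
have hkS k (kn : (k < n)%N) :
    hk k.+1 = h ord0 (Ordinal kn) *: delta_mx ord0 (Ordinal kn) + hk k.
  apply/rowP => a; rewrite !mxE eqxx /= ltnS.
  have [->|ak] := eqVneq a (Ordinal kn).
    by rewrite /= leqnn ltnn mulr1 addr0.
  have akF : (nat_of_ord a == k) = false := negbTE ak.
  by rewrite mulr0 add0r leq_eqVlt akF.
have hk_ball k c (kn : (k < n)%N) : `|c| <= `|h ord0 (Ordinal kn)| ->
    ball x r (c *: delta_mx ord0 (Ordinal kn) + (hk k + x)).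
  move=> ch; rewrite -ball_normE /= addrA opprD addrCA subrr addr0 normrN.
  apply: le_lt_trans hr; rewrite [leLHS]/Num.norm/= mx_normrE.
  apply: bigmax_le => // -[i a] _; rewrite !mxE (ord1 i) eqxx /=.
  have [->|ak] := eqVneq a (Ordinal kn).
    by rewrite /= ltnn mulr1 addr0 (le_trans ch)// norm_entry_le.
  by rewrite mulr0 add0r; case: ifP => _; rewrite ?normr0// norm_entry_le.
have step k : (k <= n)%N ->
    `|f (hk k + x) - f x - \sum_(a < n | (a < k)%N) h ord0 a * partial a f x|
      <= k%:R * (e' * `|h|).
  elim: k => [|k IH] kn.
    rewrite big_pred0// subr0 mul0r (_ : hk 0%N = 0) ?add0r ?subrr ?normr0//.
    by apply/rowP => a; rewrite !mxE.
  have {}IH := IH (ltnW kn).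
  have [|c ch E] := @MVT_line R n f (hk k + x) (delta_mx ord0 (Ordinal kn))
      (h ord0 (Ordinal kn)).
    move=> t th; have [Ay _] := rA _ (hk_ball _ _ kn th).
    by have [_ /(_ (Ordinal kn))[d _]] := Cf; exact: d.
  have [_ /(_ (Ordinal kn)) pc] := rA _ (hk_ball _ _ kn ch).
  rewrite (bigD1 (Ordinal kn)) //=.
  rewrite (eq_bigl (fun a : 'I_n => (a < k)%N)); last first.
    by move=> a /=; rewrite ltnS -val_eqE /= andbC -ltn_neqAle.
  rewrite hkS -(addrA _ (hk k) x).
  move: E pc IH; rewrite -/(partial _ _ _).
  move: (partial _ f (c *: _ + _)) => q.
  move: (f (_ + (hk k + x))) (f (hk k + x)) (f x) (partial _ f x) => u v w p.
  move: (\sum_(_ < _ | _) _) => S E pc IH.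
  have -> : u - w - (h ord0 (Ordinal kn) * p + S)
      = (v - w - S) + h ord0 (Ordinal kn) * (q - p).
    by rewrite mulrBr -E; ring.
  apply: (le_trans (ler_normD _ _)); rewrite mulrSr mulrDl mul1r lerD//.
  rewrite normrM mulrC distrC ler_pM//; exact: norm_entry_le.
have hn : hk n = h by apply/rowP => a; rewrite mxE ltn_ord.
have := step n (leqnn n); rewrite hn.
have sumE (F : 'I_n -> R) : \sum_(a < n | (a < n)%N) F a = \sum_(a < n) F a.
  by apply: eq_bigl => a; rewrite ltn_ord.
rewrite sumE.
rewrite opprD addrA => /le_trans; apply.
rewrite mulrA ler_wpM2r// /e' mulrA ler_pdivrMr// mulrC ler_wpM2l//.
by rewrite ler_nat.
Qed.

Lemma diff_partialE {R : realType} {n : nat} (f : 'rV[R]_n -> R) y v :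
  differentiable f y -> 'd f y v = \sum_(k < n) v ord0 k * partial k f y.
Proof.
move=> df; rewrite {1}(row_sum_entries v) linear_sum; apply: eq_bigr => k _.
by rewrite linearZ /partial deriveE.
Qed.

Lemma differentiable_row {R : realType} {n m : nat} (phi : 'rV[R]_n -> 'rV[R]_m) x :
  (forall k, differentiable (fun y => phi y ord0 k) x) -> differentiable phi x.
Proof.
move=> dphi.
rewrite (_ : phi = \sum_(k < m) (fun y => phi y ord0 k *: delta_mx ord0 k)); last first.
  by apply/funext => y; rewrite fct_sumE {1}(row_sum_entries (phi y)).
by apply: differentiable_sum => k; apply: differentiableZl.
Qed.

Lemma jacobianE {R : realType} {n m : nat} (phi : 'rV[R]_n -> 'rV[R]_m) x a k :
  differentiable phi x -> 'J phi x a k = partial a (fun y => phi y ord0 k) x.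
Proof.
move=> dphi; rewrite /jacobian /partial mxE -deriveE// derive_mx ?mxE//.
exact: diff_derivable.
Qed.

(** Chain rule for the convention that Jacobians act on rows from the right. *)
Lemma partial_comp {R : realType} {n m : nat} (phi : 'rV[R]_n -> 'rV[R]_m)
    (f : 'rV[R]_m -> R) x a :
  differentiable phi x -> differentiable f (phi x) ->
  partial a (f \o phi) x = \sum_(k < m) 'J phi x a k * partial k f (phi x).
Proof.
move=> dphi df; rewrite {1}/partial deriveE; last exact: differentiable_comp.
rewrite diff_comp //= diff_partialE //; apply: eq_bigr => k _.
by rewrite /jacobian mxE.
Qed.

Lemma partial_congr {R : realType} {n : nat} (A : set 'rV[R]_n) f g x a :
  open A -> (forall y, A y -> f y = g y) -> A x -> partial a f x = partial a g x.
Proof.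
move=> oA fg Ax; apply: near_eq_derive.
have : nbhs x A by exact: open_nbhs_nbhs.
by apply: filterS => y /fg.
Qed.

Lemma derivable_congr {R : realType} {n : nat} (A : set 'rV[R]_n)
    (f g : 'rV[R]_n -> R) x v :
  open A -> (forall y, A y -> f y = g y) -> A x -> derivable f x v -> derivable g x v.
Proof.
move=> oA fg Ax; apply: near_eq_derivable.
have : nbhs x A by exact: open_nbhs_nbhs.
by apply: filterS => y /fg.
Qed.

Lemma continuous_congr {R : realType} {n : nat} (A : set 'rV[R]_n)
    (f g : 'rV[R]_n -> R) x :
  open A -> (forall y, A y -> f y = g y) -> A x ->
  {for x, continuous f} -> {for x, continuous g}.
Proof.
move=> oA fg Ax fc; rewrite /prop_for /continuous_at -(fg x Ax).
have nA : nbhs x A by exact: open_nbhs_nbhs.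
apply: cvg_trans fc; apply: (@near_eq_cvg _ _ (nbhs x) _ f g).
by apply: (filterS _ nA) => y /fg.
Qed.

(** On an open set the iterated partial derivatives are local, hence depend only
    on the values there; fields given in a chart are known on its image only. *)
Lemma Ck_congr {R : realType} {n : nat} k (A : set 'rV[R]_n) f g :
  open A -> (forall y, A y -> f y = g y) -> Ck k A f -> Ck k A g.
Proof.
move=> oA; elim: k f g => [|k IH] f g fg /= [fc df]; split => //.
- by move=> x Ax; exact: continuous_congr oA fg Ax (fc x Ax).
- by move=> x Ax; exact: continuous_congr oA fg Ax (fc x Ax).
move=> a; have [da Cda] := df a; split.
  by move=> x Ax; exact: derivable_congr oA fg Ax (da x Ax).
apply: IH Cda => y Ay; exact: partial_congr oA fg Ay.
Qed.

Lemma partial_lin {R : realType} {n : nat} (c : R) (f g : 'rV[R]_n -> R) x a :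
  derivable f x (delta_mx ord0 a) -> derivable g x (delta_mx ord0 a) ->
  partial a (fun y => c * f y + g y) x = c * partial a f x + partial a g x.
Proof.
move=> df dg; rewrite /partial.
have -> : (fun y => c * f y + g y) = c \*: (f : 'rV[R]_n -> R^o) + g by [].
rewrite deriveD; [|exact: derivableZ|exact: dg].
by rewrite deriveZ; [|exact: df].
Qed.

Lemma derivable_lin {R : realType} {n : nat} (c : R) (f g : 'rV[R]_n -> R) x v :
  derivable f x v -> derivable g x v -> derivable (fun y => c * f y + g y) x v.
Proof.
move=> df dg.
have -> : (fun y => c * f y + g y) = c \*: (f : 'rV[R]_n -> R^o) + g by [].
by apply: derivableD; [exact: derivableZ|exact: dg].
Qed.

Lemma Ck_lin {R : realType} {n : nat} k (A : set 'rV[R]_n) (c : R) f g :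
  open A -> Ck k A f -> Ck k A g -> Ck k A (fun y => c * f y + g y).
Proof.
move=> oA; elim: k f g => [|k IH] f g /= [fc df] [gc dg]; split => //.
- move=> x Ax; apply: (@continuousD _ _ _ (fun y => c * f y) g); last exact: gc.
  by apply: (@continuousM _ _ (cst c) f); [exact: cst_continuous|exact: fc].
- move=> x Ax; apply: (@continuousD _ _ _ (fun y => c * f y) g); last exact: gc.
  by apply: (@continuousM _ _ (cst c) f); [exact: cst_continuous|exact: fc].
move=> a; have [da Cda] := df a; have [ga Cga] := dg a; split.
  by move=> x Ax; apply: derivable_lin; [exact: da|exact: ga].
apply: (@Ck_congr _ _ _ _ (fun y => c * partial a f y + partial a g y) _ oA _
  (IH _ _ Cda Cga)) => y Ay.
by rewrite partial_lin; [|exact: da|exact: ga].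
Qed.

Lemma partialM {R : realType} {n : nat} (f g : 'rV[R]_n -> R) x a :
  derivable f x (delta_mx ord0 a) -> derivable g x (delta_mx ord0 a) ->
  partial a (fun y => f y * g y) x = partial a f x * g x + f x * partial a g x.
Proof.
move=> df dg; rewrite /partial.
have -> : (fun y => f y * g y) = f * g by [].
rewrite deriveM; [|exact: df|exact: dg].
by rewrite addrC [X in _ = X + _]mulrC.
Qed.

Lemma derivable_mul_fun {R : realType} {n : nat} (f g : 'rV[R]_n -> R) x v :
  derivable f x v -> derivable g x v -> derivable (fun y => f y * g y) x v.
Proof. exact: derivableM. Qed.

Lemma partial_sum {R : realType} {n m : nat} (f : 'I_m -> 'rV[R]_n -> R) x a :
  (forall k, derivable (f k) x (delta_mx ord0 a)) ->
  partial a (fun y => \sum_k f k y) x = \sum_k partial a (f k) x.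
Proof.
move=> df; rewrite /partial -derive_sum//; congr ('D__ _ _).
by apply/funext => y; rewrite fct_sumE.
Qed.

Lemma derivable_sum_fun {R : realType} {n m : nat} (f : 'I_m -> 'rV[R]_n -> R) x v :
  (forall k, derivable (f k) x v) -> derivable (fun y => \sum_k f k y) x v.
Proof.
move=> df; have -> : (fun y => \sum_k f k y) = \sum_k f k.
  by apply/funext => y; rewrite fct_sumE.
exact: derivable_sum.
Qed.

Lemma Ck_derivable {R : realType} {n : nat} k (A : set 'rV[R]_n) f x a :
  Ck k.+1 A f -> A x -> derivable f x (delta_mx ord0 a).
Proof. by move=> [_ /(_ a)[+ _]]; apply. Qed.

Lemma Ck_partial {R : realType} {n : nat} k (A : set 'rV[R]_n) f a :
  Ck k.+1 A f -> Ck k A (partial a f).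
Proof. by move=> [_ /(_ a)[]]. Qed.

Lemma Ck_continuous {R : realType} {n : nat} k (A : set 'rV[R]_n) f x :
  Ck k A f -> A x -> {for x, continuous f}.
Proof. by case: k => [|k] [fc _]; apply: fc. Qed.

(** * Norms of covectors and 2-tensors *)

Lemma posdef_unitmx {R : realFieldType} {n : nat} (G : 'M[R]_n) :
  (forall v : 'rV[R]_n, v != 0 -> 0 < (v *m G *m v^T) ord0 ord0) -> G \in unitmx.
Proof.
move=> Gpos; rewrite -row_free_unit; apply: inj_row_free => v vG.
apply/eqP; apply: contraT => /Gpos.
by rewrite vG mul0mx mxE ltxx.
Qed.

(** Induction on the size: after the first row and column are eliminated, what
    remains is the Schur complement [S] of the pivot, which is again positive
    definite. *)
Lemma cholesky {R : rcfType} {n : nat} (G : 'M[R]_n) :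
  G^T = G ->
  (forall v : 'rV[R]_n, v != 0 -> 0 < (v *m G *m v^T) ord0 ord0) ->
  exists L : 'M[R]_n, G = L *m L^T.
Proof.
elim: n G => [|n IH] G symG posG.
  by exists 0; apply/matrixP => -[].
pose G' : 'M[R]_(1 + n) := G.
have symG' : G'^T = G' := symG.
pose a := G ord0 ord0; pose r := ursubmx G'; pose C := drsubmx G'.
have EG : G' = block_mx a%:M r r^T C.
  rewrite -[LHS]submxK; congr block_mx.
    rewrite [LHS]mx11_scalar; congr (_%:M); rewrite !mxE /a; congr (G _ _); exact: val_inj.
  by rewrite /r trmx_ursub symG'.
have symC : C^T = C by rewrite /C trmx_drsub symG'.
have a0 : 0 < a.
  have := posG (delta_mx ord0 ord0); rewrite -rowE trmx_delta -colE !mxE; apply.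
  apply/eqP => /matrixP/(_ ord0 ord0)/eqP; rewrite !mxE !eqxx /=.
  by rewrite oner_eq0.
pose S := C - a^-1 *: (r^T *m r).
have [|y y0|L EL] := IH S.
- by rewrite /S linearB linearZ /= trmx_mul trmxK symC.
- pose s := (y *m r^T) ord0 ord0.
  have Es : y *m r^T = s%:M by rewrite [LHS]mx11_scalar.
  have Es' : r *m y^T = s%:M by rewrite -[LHS]trmxK trmx_mul trmxK Es tr_scalar_mx.
  (* [- (s / a)] minimizes the form over the first coordinate; the minimum is the
     value of [S] at [y] *)
  have := posG (row_mx (- (s / a))%:M y : 'rV[R]_(1 + n)).
  rewrite -[G]/G' EG.
  set v := row_mx _ _.
  have -> : v *m block_mx a%:M r r^T C *m v^T = y *m S *m y^T.
    rewrite /v mul_row_block tr_row_mx mul_row_col tr_scalar_mx Es -scalar_mxM.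
    rewrite -raddfD /= mulNr divfK ?gt_eqF// addNr raddf0 mul0mx add0r.
    rewrite mulmxDl -mulmxA Es' -scalar_mxM /S mulmxBr mulmxBl addrC.
    rewrite -scalemxAr -scalemxAl (mulmxA y r^T) Es -(mulmxA _ r) Es' -scalar_mxM scale_scalar_mx.
    by rewrite -raddfN /=; congr (_ + _%:M); rewrite mulNr mulrA (mulrC s).
  apply.
  apply: contra_neq y0 => v0; have := congr1 (@rsubmx _ 1 1 n) v0.
  by rewrite row_mxKr => ->; rewrite linear0.
pose L' : 'M[R]_(1 + n) := block_mx (Num.sqrt a)%:M 0 ((Num.sqrt a)^-1 *: r^T) L.
exists L'; rewrite -[LHS]/G' -[RHS]/(L' *m L'^T) EG /L' tr_block_mx mulmx_block.
rewrite !tr_scalar_mx linearZ /= trmxK trmx0 !mul0mx !mulmx0 !addr0.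
have sa0 : Num.sqrt a != 0 by rewrite gt_eqF ?sqrtr_gt0.
rewrite -!scalar_mxM -expr2 sqr_sqrtr ?(ltW a0)//.
rewrite mul_scalar_mx mul_mx_scalar !scalerA mulfV// scale1r.
rewrite -scalemxAl -scalemxAr scalerA -EL -invfM -expr2 sqr_sqrtr ?(ltW a0)//.
by rewrite /S scale1r addrC subrK.
Qed.

Lemma invmx_mul {F : comUnitRingType} {n : nat} (A B : 'M[F]_n) :
  A \in unitmx -> B \in unitmx -> invmx (A *m B) = invmx B *m invmx A.
Proof.
move=> uA uB; have uAB : A *m B \in unitmx by rewrite unitmx_mul uA.
apply: (can_inj (mulKmx uAB)); rewrite mulmxV // !mulmxA.
by rewrite mulmxK // mulmxV.
Qed.

Lemma inv_posdef_factor {R : rcfType} {n : nat} (G : 'M[R]_n) :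
  G^T = G ->
  (forall v : 'rV[R]_n, v != 0 -> 0 < (v *m G *m v^T) ord0 ord0) ->
  exists L : 'M[R]_n, invmx G = L *m L^T.
Proof.
move=> symG posG; have [M E] := cholesky symG posG.
have uG := posdef_unitmx posG.
have uM : M \in unitmx by move: uG; rewrite E unitmx_mul => /andP[].
exists (invmx M)^T; rewrite trmxK trmx_inv E.
have uMt : M^T \in unitmx by rewrite unitmx_tr.
by rewrite invmx_mul.
Qed.

Lemma trace_mul_tr {R : comPzRingType} {n m : nat} (A : 'M[R]_(n, m)) :
  \tr (A *m A^T) = \sum_i \sum_j A i j ^+ 2.
Proof.
apply: eq_bigr => i _; rewrite !mxE; apply: eq_bigr => j _.
by rewrite mxE expr2.
Qed.

Section charts.
Variables (R : realType) (n : nat) (M : ptopologicalType) (g : riemannian R n M).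
Implicit Types (i j : chart g) (p : M).

(** The squared norms of a covector and of a 2-tensor computed in a fixed chart,
    whereas [form_norm_sq] and [tensor2_norm_sq] use the chart [chart_at g p], which
    varies with [p]. *)
Definition covector_nsq i p (w : 'cV[R]_n) : R := (w^T *m invmx (metric i p) *m w) ord0 ord0.
Definition tensor_nsq i p (T : 'M[R]_n) : R :=
  \tr (invmx (metric i p) *m T *m invmx (metric i p) *m T^T).

Lemma metric_unit i p : chart_dom i p -> metric i p \in unitmx.
Proof. by move=> ip; apply: posdef_unitmx; exact: metric_pos. Qed.

Lemma metric_inv_sym i p : chart_dom i p -> (invmx (metric i p))^T = invmx (metric i p).
Proof. by move=> ip; rewrite trmx_inv Defs.metric_sym. Qed.

Lemma norm_sq_sharp i p w : chart_dom i p -> norm_sq i p (sharp i p w) = covector_nsq i p w.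
Proof.
move=> ip; rewrite /norm_sq /covector_nsq /sharp trmxK trmx_mul metric_inv_sym//.
by rewrite mulmxA -(mulmxA _ (invmx _) (metric i p)) mulVmx ?metric_unit// mulmx1.
Qed.

Lemma form_norm_sqE (w : field1 g) p :
  form_norm_sq w p = covector_nsq (chart_at g p) p (w (chart_at g p) p).
Proof. by rewrite -norm_sq_sharp//; exact: dom_chart_at. Qed.

(** Factoring the inverse metric turns both norms into sums of squares of linear
    functions, so that their inequalities can be checked square by square. *)
Lemma covector_nsq_factor i p : chart_dom i p -> exists L : 'M[R]_n,
  forall w, covector_nsq i p w = \sum_a ((L^T *m w) a ord0) ^+ 2.
Proof.
move=> ip; have [L E] := inv_posdef_factor (Defs.metric_sym ip) (metric_pos ip).
exists L => w; rewrite /covector_nsq E mulmxA -mulmxA.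
have -> : w^T *m L = (L^T *m w)^T by rewrite trmx_mul trmxK.
by rewrite mxE; apply: eq_bigr => a _; rewrite mxE expr2.
Qed.

Lemma tensor_nsq_factor i p : chart_dom i p -> exists L : 'M[R]_n,
  forall T, tensor_nsq i p T = \sum_a \sum_b ((L^T *m T *m L) a b) ^+ 2.
Proof.
move=> ip; have [L E] := inv_posdef_factor (Defs.metric_sym ip) (metric_pos ip).
exists L => T; rewrite /tensor_nsq E -trace_mul_tr.
rewrite -!mulmxA mxtrace_mulC !trmx_mul trmxK.
by rewrite !mulmxA.
Qed.

Lemma covector_nsq_ge0 i p w : chart_dom i p -> 0 <= covector_nsq i p w.
Proof. by move=> /covector_nsq_factor[L ->]; apply: sumr_ge0 => a _; exact: sqr_ge0. Qed.

Lemma tensor_nsq_ge0 i p T : chart_dom i p -> 0 <= tensor_nsq i p T.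
Proof.
move=> /tensor_nsq_factor[L ->]; apply: sumr_ge0 => a _; apply: sumr_ge0 => b _.
exact: sqr_ge0.
Qed.

Lemma sqr_lin_le (c x y : R) : (c * x + y) ^+ 2 <= 2 * c ^+ 2 * x ^+ 2 + 2 * y ^+ 2.
Proof.
have := sqr_ge0 (c * x - y); rewrite sqrrB sqrrD !exprMn; lra.
Qed.

Lemma covector_nsq_lin_le i p c w w' : chart_dom i p ->
  covector_nsq i p (c *: w + w') <= 2 * c ^+ 2 * covector_nsq i p w + 2 * covector_nsq i p w'.
Proof.
move=> /covector_nsq_factor[L E]; rewrite !E !mulr_sumr -big_split /=; apply: ler_sum => a _.
rewrite mulmxDr -scalemxAr.
have := sqr_lin_le c ((L^T *m w) a ord0) ((L^T *m w') a ord0).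
by move: (L^T *m w) (L^T *m w') => A B; rewrite !mxE.
Qed.

Lemma tensor_nsq_lin_le i p c T T' : chart_dom i p ->
  tensor_nsq i p (c *: T + T') <= 2 * c ^+ 2 * tensor_nsq i p T + 2 * tensor_nsq i p T'.
Proof.
move=> /tensor_nsq_factor[L E]; rewrite !E !mulr_sumr -big_split /=; apply: ler_sum => a _.
rewrite !mulr_sumr -big_split /=; apply: ler_sum => b _.
rewrite mulmxDr mulmxDl -scalemxAr -scalemxAl.
have := sqr_lin_le c ((L^T *m T *m L) a b) ((L^T *m T' *m L) a b).
by move: (L^T *m T *m L) (L^T *m T' *m L) => A B; rewrite !mxE.
Qed.

Lemma covector_nsqZ i p c w : covector_nsq i p (c *: w) = c ^+ 2 * covector_nsq i p w.
Proof. have E : (c *: w)^T = c *: w^T by rewrite linearZ.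
by rewrite /covector_nsq E -!scalemxAl -scalemxAr scalerA -expr2 mxE. Qed.

Lemma tensor_nsqZ i p c T : tensor_nsq i p (c *: T) = c ^+ 2 * tensor_nsq i p T.
Proof.
have E : (c *: T)^T = c *: T^T by rewrite linearZ.
by rewrite /tensor_nsq E -!scalemxAr -!scalemxAl scalerA -expr2 mxtraceZ.
Qed.

Lemma jacobian_unit i j p : chart_dom i p -> chart_dom j p ->
  transition_jacobian i j p \in unitmx.
Proof.
move=> ip jp; have := metric_unit ip; rewrite (metric_compat ip jp).
by rewrite !unitmx_mul => /andP[/andP[]].
Qed.

Lemma metric_inv_compat i j p : chart_dom i p -> chart_dom j p ->
  let J := transition_jacobian i j p in
  invmx (metric i p) = (invmx J)^T *m invmx (metric j p) *m invmx J.
Proof.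
move=> ip jp J; have uJ : J \in unitmx by exact: jacobian_unit.
rewrite (metric_compat ip jp) -/(transition_jacobian i j p) -/J.
rewrite !invmx_mul ?unitmx_mul ?unitmx_tr ?uJ ?metric_unit//.
by rewrite trmx_inv mulmxA.
Qed.

(** The Jacobians of the tensor cancel those of the inverse metric. *)
Lemma covector_nsq_compat i j p w w' : chart_dom i p -> chart_dom j p ->
  w = transition_jacobian i j p *m w' -> covector_nsq i p w = covector_nsq j p w'.
Proof.
move=> ip jp ->; rewrite /covector_nsq (metric_inv_compat ip jp).
set J := transition_jacobian i j p.
have uJ : J \in unitmx by exact: jacobian_unit.
rewrite trmx_mul !mulmxA -(mulmxA w'^T) -trmx_mul mulVmx// trmx1 mulmx1.
by rewrite -(mulmxA _ (invmx J)) mulVmx// mulmx1.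
Qed.

Lemma tensor_nsq_compat i j p T T' : chart_dom i p -> chart_dom j p ->
  T = transition_jacobian i j p *m T' *m (transition_jacobian i j p)^T ->
  tensor_nsq i p T = tensor_nsq j p T'.
Proof.
move=> ip jp ->; rewrite /tensor_nsq (metric_inv_compat ip jp).
set J := transition_jacobian i j p.
have uJ : J \in unitmx by exact: jacobian_unit.
set H := invmx (metric j p); set K := invmx J.
have KJ : K *m J = 1%:M by rewrite mulVmx.
have JK : J^T *m K^T = 1%:M by rewrite -trmx_mul KJ trmx1.
have E (X : 'M[R]_n) : K^T *m H *m K *m (J *m X *m J^T) = K^T *m (H *m X) *m J^T.
  by rewrite !mulmxA -(mulmxA _ K J) KJ mulmx1.
rewrite !trmx_mul trmxK (mulmxA J) -mulmxA !E.
have F (A B : 'M[R]_n) :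
    K^T *m A *m J^T *m (K^T *m B *m J^T) = K^T *m (A *m B *m J^T).
  by rewrite !mulmxA -(mulmxA _ J^T K^T) JK mulmx1.
by rewrite F mxtrace_mulC -!mulmxA JK mulmx1 !mulmxA.
Qed.

Lemma tensor_nsq_at (Omega : set M) (T : field2 g) i p : is_tensor2 Omega T -> Omega p ->
  chart_dom i p -> tensor2_norm_sq T p = tensor_nsq i p (T i p).
Proof.
move=> tT Op ip; have ap := dom_chart_at g p.
exact: (tensor_nsq_compat ap ip (tT _ _ _ Op ap ip)).
Qed.

Lemma covector_nsq_at (Omega : set M) (w : field1 g) i p : is_form Omega w -> Omega p ->
  chart_dom i p -> form_norm_sq w p = covector_nsq i p (w i p).
Proof.
move=> tw Op ip; have ap := dom_chart_at g p.
by rewrite form_norm_sqE; exact: (covector_nsq_compat ap ip (tw _ _ _ Op ap ip)).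
Qed.

End charts.

(** * The covariant derivative of a form is a tensor *)

(** Algebraic core of the transformation law of the Christoffel symbols.  For a
    change of coordinates [phi] with Jacobian [J] and second derivatives
    [P c d k = d_c d_d phi^k], the metric is [J *m h *m J^T] and [dG c] is its
    derivative along [c] by the product rule.  In the Koszul combination
    [dG a b d + dG b a d - dG d a b] the six terms that contain second derivatives
    cancel in pairs, by symmetry of [P] and [h], except for two equal ones; the
    terms with [dh] are the same combination in the new coordinates. *)
Lemma koszul_change {R : comPzRingType} {n : nat} (J h : 'M[R]_n)
    (P dh : 'I_n -> 'M[R]_n) (v : 'rV[R]_n) (a b : 'I_n) :
  h^T = h -> (forall c d k, P c d k = P d c k) ->
  let dG c := P c *m h *m J^T + J *m (\sum_m J c m *: dh m) *m J^T
              + J *m h *m (P c)^T in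
  let V := v *m J in
  \sum_d v ord0 d * (dG a b d + dG b a d - dG d a b) =
    (P a *m (h *m V^T)) b ord0 *+ 2 +
    (J *m (\matrix_(m, k) \sum_d V ord0 d * (dh m k d + dh k m d - dh d m k)) *m J^T) a b.
Proof.
move=> symh symP dG V.
pose Q := \matrix_(m, k) (dh m *m V^T) k ord0.
pose Z := \sum_d V ord0 d *: dh d.
(* [X] collects the contributions of [P] that cancel in the end *)
pose Pv := \sum_d v ord0 d *: P d.
pose X := J *m h *m Pv^T.
have EV : J^T *m v^T = V^T by rewrite trmx_mul.
have PvE c l : Pv c l = ((P c)^T *m v^T) l ord0.
  rewrite /Pv summxE !mxE; apply: eq_bigr => d _; rewrite !mxE symP mulrC; exact: erefl.
have trJ (A : 'M[R]_n) : (J *m A *m J^T)^T = J *m A^T *m J^T.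
  by rewrite !trmx_mul trmxK mulmxA.
have rowJ (A : 'M[R]_n) c d : (A *m J^T) d c = (A *m (row c J)^T) d ord0.
  by rewrite !mxE; apply: eq_bigr => k _; rewrite !mxE.
have EQ c d : (dG c *m v^T) d ord0 =
    (P c *m (h *m V^T)) d ord0 + (J *m Q *m J^T) c d + X d c.
  have E2 : (\sum_m J c m *: dh m) *m V^T = Q^T *m (row c J)^T.
    apply/colP => k; rewrite mulmx_suml summxE [RHS]mxE; apply: eq_bigr => m _.
    by rewrite -scalemxAl mxE mulrC [in RHS]mxE [Q m k]mxE !mxE.
  have E3 : (J *m h *m (P c)^T *m v^T) d ord0 = X d c.
    rewrite -mulmxA mxE /X [RHS]mxE; apply: eq_bigr => l _.
    by rewrite [Pv^T l c]mxE PvE.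
  rewrite /dG !mulmxDl [LHS]mxE E3 [X in X + _ = _]mxE; congr (_ + _ + _).
    by rewrite -!mulmxA EV.
  rewrite -(mulmxA _ J^T) EV -(mulmxA J) E2 mulmxA -rowJ.
  by rewrite -trJ mxE.
have EZ : (\sum_d v ord0 d *: dG d) a b = X b a + (J *m Z *m J^T) a b + X a b.
  have E1 : Pv *m h *m J^T = X^T.
    by rewrite /X !trmx_mul trmxK symh mulmxA.
  have E2 : \sum_d v ord0 d *: (\sum_m J d m *: dh m) = Z.
    under eq_bigr do rewrite scaler_sumr.
    rewrite exchange_big /Z; apply: eq_bigr => m _.
    by rewrite mxE scaler_suml; apply: eq_bigr => d _; rewrite scalerA.
  rewrite (_ : \sum_d _ = X^T + J *m Z *m J^T + X).
    by rewrite [LHS]mxE [X in X + _ = _]mxE [X^T a b]mxE.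
  under eq_bigr do rewrite !scalerDr.
  rewrite !big_split /= -E1 -E2; congr (_ + _ + _).
  - by rewrite /Pv !mulmx_suml; apply: eq_bigr => d _; rewrite !scalemxAl.
  - rewrite mulmx_sumr mulmx_suml; apply: eq_bigr => d _.
    by rewrite -scalemxAr scalemxAl.
  - rewrite /X /Pv linear_sum mulmx_sumr; apply: eq_bigr => d _.
    by rewrite linearZ /= -scalemxAr.
have -> : \matrix_(m, k) (\sum_d V ord0 d * (dh m k d + dh k m d - dh d m k))
    = Q + Q^T - Z.
  apply/matrixP => m k; rewrite !mxE /Z summxE -big_split -sumrB /=.
  by apply: eq_bigr => d _; rewrite !mxE mulrBr mulrDr; congr (_ + _ - _); rewrite mulrC.
transitivity ((dG a *m v^T) b ord0 + (dG b *m v^T) a ord0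
    - (\sum_d v ord0 d *: dG d) a b).
  rewrite !mxE summxE -big_split -sumrB /=; apply: eq_bigr => d _.
  by rewrite [in RHS]mxE mulrBr mulrDr; rewrite !mxE [X in _ = X + _ - _]mulrC [X in _ = _ + X - _]mulrC.
rewrite EZ !EQ.
have -> : (P b *m (h *m V^T)) a ord0 = (P a *m (h *m V^T)) b ord0.
  by rewrite !mxE; apply: eq_bigr => k _; rewrite symP.
have -> : (J *m Q *m J^T) b a = (J *m Q^T *m J^T) a b.
  by rewrite -[in RHS]trJ [RHS]mxE.
rewrite mulmxBr mulmxBl mulmxDr mulmxDl.
have addE (A B C : 'M[R]_n) : (A + B - C) a b = A a b + B a b - C a b.
  by rewrite !mxE.
by rewrite addE mulr2n; ring.
Qed.

Section charts_calculus.
Variables (R : realType) (n : nat) (M : ptopologicalType) (g : riemannian R n M).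
Implicit Types (i j : chart g) (p : M) (Omega U : set M).

Lemma chart_image_open i U : open U -> open (chart_coord i @` (chart_dom i `&` U)).
Proof.
move=> oU; rewrite openE => _ [p [ip Up] <-].
have nD : nbhs (chart_coord i p) (chart_coord i @` chart_dom i).
  by apply: open_nbhs_nbhs; split; [exact: codom_open | exists p].
have nU : nbhs (chart_coord i p) (chart_inv i @^-1` U).
  apply: (@coord_inv_continuous _ _ _ g i (chart_coord i p)); first by exists p.
  by apply: open_nbhs_nbhs; split => //; rewrite (coordK ip).
apply: filterS (filterI nD nU) => _ [[q iq <-]] /=; rewrite (coordK iq) => Uq.
by exists q.
Qed.

Definition transition i j (x : 'rV[R]_n) := chart_coord j (chart_inv i x).

Definition overlap i j := chart_coord i @` (chart_dom i `&` chart_dom j).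

Lemma overlap_open i j : open (overlap i j).
Proof. by apply: chart_image_open; exact: dom_open. Qed.

Lemma transition_entry_Ck k i j (a : 'I_n) :
  Ck k (overlap i j) (fun x => transition i j x ord0 a).
Proof. exact: transition_smooth. Qed.

Lemma transition_differentiable i j x : overlap i j x ->
  differentiable (transition i j) x.
Proof.
move=> Dx; apply: differentiable_row => k.
exact: (C1_differentiable (@overlap_open i j) (transition_entry_Ck 1 i j k) Dx).
Qed.

(** The second derivatives of the transition map are what keeps derivatives of
    components from being tensors. *)
Definition transition_second i j p (c : 'I_n) : 'M[R]_n :=
  \matrix_(a, k) partial c (partial a (fun x => transition i j x ord0 k)) (chart_coord i p).

Lemma transition_second_sym i j p c d k : chart_dom i p -> chart_dom j p ->
  transition_second i j p c d k = transition_second i j p d c k.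
Proof.
move=> ip jp; rewrite [LHS]mxE [RHS]mxE.
have Dp : overlap i j (chart_coord i p) by exists p.
exact: (partialC c d (@overlap_open i j) (transition_entry_Ck 2 i j k) Dp).
Qed.

Lemma transition_jacobianE i j p a k : chart_dom i p -> chart_dom j p ->
  transition_jacobian i j p a k =
  partial a (fun x => transition i j x ord0 k) (chart_coord i p).
Proof.
move=> ip jp; apply: (@jacobianE _ _ _ (transition i j)).
by apply: transition_differentiable; exists p.
Qed.

Lemma partial_transition i j p (f : 'rV[R]_n -> R) a :
  chart_dom i p -> chart_dom j p -> differentiable f (chart_coord j p) ->
  partial a (f \o transition i j) (chart_coord i p) =
  \sum_k transition_jacobian i j p a k * partial k f (chart_coord j p).
Proof.
move=> ip jp df.
have E : transition i j (chart_coord i p) = chart_coord j p.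
  by rewrite /transition (coordK ip).
have dphi : differentiable (transition i j) (chart_coord i p).
  by apply: transition_differentiable; exists p.
rewrite partial_comp; [by rewrite E | exact: dphi | by rewrite E].
Qed.

Lemma derivable_transition i j p (f : 'rV[R]_n -> R) v :
  chart_dom i p -> chart_dom j p -> differentiable f (chart_coord j p) ->
  derivable (f \o transition i j) (chart_coord i p) v.
Proof.
move=> ip jp df; apply: diff_derivable; apply: differentiable_comp.
  by apply: transition_differentiable; exists p.
by rewrite /transition (coordK ip).
Qed.

Definition dmetric i p (c : 'I_n) : 'M[R]_n :=
  \matrix_(a, b) partial c (fun x => metric i (chart_inv i x) a b) (chart_coord i p).

Lemma dmetricE i p c a b : dmetric i p c a b =
  partial c (fun x => metric i (chart_inv i x) a b) (chart_coord i p).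
Proof. by rewrite mxE. Qed.

Definition lowered_christoffel i p (v : 'rV[R]_n) (a b : 'I_n) : R :=
  \sum_d v ord0 d * (dmetric i p a b d + dmetric i p b a d - dmetric i p d a b).

(** Contracting with a covector replaces the inverse metric in the Christoffel
    symbols by the vector [sharp i p w]. *)
Lemma christoffel_contract i p (w : 'cV[R]_n) a b : chart_dom i p ->
  \sum_c christoffel i c a b (chart_coord i p) * w c ord0 =
  2^-1 * lowered_christoffel i p (sharp i p w) a b.
Proof.
move=> ip; rewrite /lowered_christoffel mulr_sumr.
under eq_bigr do rewrite /christoffel -mulrA mulr_suml mulr_sumr.
rewrite exchange_big; apply: eq_bigr => d _.
rewrite -mulr_sumr; congr (_ * _).
rewrite /sharp [in RHS]mxE [in RHS]mxE mulr_suml; apply: eq_bigr => c _.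
rewrite (coordK ip) mulrAC; congr (_ * _ * _).
by rewrite -[in LHS](metric_inv_sym ip) mxE.
by rewrite -!dmetricE.
Qed.

Lemma metric_entry_differentiable i p a b : chart_dom i p ->
  differentiable (fun x => metric i (chart_inv i x) a b) (chart_coord i p).
Proof.
move=> ip; apply: (C1_differentiable (@codom_open R n M g i)).
  exact: metric_smooth.
by exists p.
Qed.

(** Product rule applied to [metric_compat] near [p]; the second derivatives of the
    transition map come from its Jacobian, the middle term from the chain rule. *)
Lemma dmetric_change i j p c : chart_dom i p -> chart_dom j p ->
  let J := transition_jacobian i j p in let P := transition_second i j p c in
  dmetric i p c = P *m metric j p *m J^T
    + J *m (\sum_m J c m *: dmetric j p m) *m J^T + J *m metric j p *m P^T.
Proof.
move=> ip jp J P.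
pose x0 := chart_coord i p.
have Dx0 : overlap i j x0 by exists p.
have E0 : transition i j x0 = chart_coord j p by rewrite /transition (coordK ip).
pose f a k x := partial a (fun y => transition i j y ord0 k) x.
pose H k l y := metric j (chart_inv j y) k l.
have df a k v : derivable (f a k) x0 (delta_mx ord0 v).
  exact: (Ck_derivable (Ck_partial _ (transition_entry_Ck 2 i j k)) Dx0).
have dH k l v : derivable (H k l \o transition i j) x0 v.
  by apply: derivable_transition => //; exact: metric_entry_differentiable.
have fE a k : f a k x0 = J a k by rewrite /J transition_jacobianE.
have PE a k : partial c (f a k) x0 = P a k by rewrite /P mxE.
have HE k l : (H k l \o transition i j) x0 = metric j p k l.
  by rewrite /H /= E0 (coordK jp).
have dHE k l : partial c (H k l \o transition i j) x0
    = (\sum_m J c m *: dmetric j p m) k l.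
  rewrite partial_transition//; last exact: metric_entry_differentiable.
  by rewrite summxE; apply: eq_bigr => m _; rewrite !mxE.
have local x a b : overlap i j x -> metric i (chart_inv i x) a b =
    \sum_k \sum_l f a k x * ((H k l \o transition i j) x * f b l x).
  move=> [q [iq jq] <-]; rewrite (coordK iq) (metric_compat iq jq).
  rewrite -/(transition_jacobian i j q) -mulmxA mxE; apply: eq_bigr => k _.
  rewrite [(metric j q *m _) k b]mxE mulr_sumr; apply: eq_bigr => l _.
  rewrite [(_^T) l b]mxE /f -!transition_jacobianE//; congr (_ * (_ * _)).
  by rewrite /H /= /transition (coordK iq) (coordK jq).
apply/matrixP => a b; rewrite mxE.
rewrite (partial_congr _ (@overlap_open i j) (fun x Dx => local x a b Dx) Dx0).
have dprod k l : derivable (fun x => (H k l \o transition i j) x * f b l x) x0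
    (delta_mx ord0 c).
  by apply: derivable_mul_fun; [exact: dH | exact: df].
have dterm k l : derivable (fun x => f a k x * ((H k l \o transition i j) x * f b l x)) x0
    (delta_mx ord0 c).
  by apply: derivable_mul_fun; [exact: df | exact: dprod].
rewrite partial_sum; last by move=> k; apply: derivable_sum_fun => l; exact: dterm.
pose S := \sum_m J c m *: dmetric j p m.
transitivity (\sum_k \sum_l (P a k * (metric j p k l * J b l)
    + J a k * (S k l * J b l) + J a k * (metric j p k l * P b l))).
  apply: eq_bigr => k _; rewrite partial_sum; last by move=> l; exact: dterm.
  apply: eq_bigr => l _.
  rewrite partialM; [|exact: df|exact: dprod].
  rewrite partialM; [|exact: dH|exact: df].
  by rewrite PE !fE HE dHE PE mulrDr addrA.
have triple (A B C : 'M[R]_n) : (A *m B *m C^T) a b =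
    \sum_k \sum_l A a k * (B k l * C b l).
  rewrite -mulmxA mxE; apply: eq_bigr => k _; rewrite mxE mulr_sumr.
  by apply: eq_bigr => l _; rewrite [C^T _ _]mxE.
rewrite [RHS]mxE [X in _ = X + _]mxE !triple -!big_split /=.
by apply: eq_bigr => k _; rewrite -!big_split.
Qed.

Lemma sharp_change i j p (w w' : 'cV[R]_n) : chart_dom i p -> chart_dom j p ->
  w = transition_jacobian i j p *m w' ->
  sharp i p w *m transition_jacobian i j p = sharp j p w'.
Proof.
move=> ip jp ->; rewrite /sharp (metric_inv_compat ip jp).
set J := transition_jacobian i j p.
have uJ : J \in unitmx by exact: jacobian_unit.
rewrite -!mulmxA (mulmxA (invmx J)) mulVmx// mul1mx.
by rewrite trmx_mul trmxK -mulmxA mulVmx// mulmx1.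
Qed.

Definition dform (w : field1 g) i p : 'M[R]_n :=
  \matrix_(a, b) partial a (fun x => w i (chart_inv i x) b ord0) (chart_coord i p).

(** Product rule applied to the transformation law of [w]; the first term is the
    one that makes [dform] fail to be a tensor. *)
Lemma dform_change Omega (w : field1 g) i j p a b : open Omega -> smooth_form Omega w ->
  Omega p -> chart_dom i p -> chart_dom j p ->
  let J := transition_jacobian i j p in
  dform w i p a b = (transition_second i j p a *m w j p) b ord0 + (J *m dform w j p *m J^T) a b.
Proof.
move=> oO [tw sw] Op ip jp J.
pose x0 := chart_coord i p.
pose D := chart_coord i @` (chart_dom i `&` (chart_dom j `&` Omega)).
have oD : open D by apply: chart_image_open; apply: openI => //; exact: dom_open.
have Dx0 : D x0 by exists p.
have E0 : transition i j x0 = chart_coord j p by rewrite /transition (coordK ip).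
pose f b' k x := partial b' (fun y => transition i j y ord0 k) x.
pose W k y := w j (chart_inv j y) k ord0.
have Ox0 : overlap i j x0 by exists p.
have df b' k v : derivable (f b' k) x0 (delta_mx ord0 v).
  exact: (Ck_derivable (Ck_partial _ (transition_entry_Ck 2 i j k)) Ox0).
have diffW k : differentiable (W k) (chart_coord j p).
  apply: (@C1_differentiable _ _ (chart_coord j @` (chart_dom j `&` Omega))).
  - exact: chart_image_open.
  - exact: sw.
  - by exists p.
have dW k v : derivable (W k \o transition i j) x0 v.
  by apply: derivable_transition.
have local x : D x -> w i (chart_inv i x) b ord0 =
    \sum_k f b k x * (W k \o transition i j) x.
  move=> [q [iq [jq Oq]] <-]; rewrite (coordK iq) (tw i j q Oq iq jq) mxE.
  apply: eq_bigr => k _; rewrite /f -transition_jacobianE//.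
  by rewrite /W /= /transition (coordK iq) (coordK jq).
rewrite mxE (partial_congr _ oD local Dx0).
have dterm k : derivable (fun x => f b k x * (W k \o transition i j) x) x0
    (delta_mx ord0 a).
  by apply: derivable_mul_fun; [exact: df | exact: dW].
rewrite partial_sum; last exact: dterm.
have triple (A B C : 'M[R]_n) : (A *m B *m C^T) a b =
    \sum_k C b k * (\sum_l A a l * B l k).
  by rewrite mxE; apply: eq_bigr => k _; rewrite mulrC !mxE.
rewrite triple [X in _ = X + _]mxE -big_split /=; apply: eq_bigr => k _.
rewrite partialM; [|exact: df|exact: dW].
congr (_ + _).
  by rewrite [transition_second _ _ _ _ _ _]mxE /W /= E0 (coordK jp).
rewrite {1}/f -transition_jacobianE//; congr (_ * _).
by rewrite partial_transition//; apply: eq_bigr => m _; rewrite [dform _ _ _ _ _]mxE.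
Qed.

Lemma covariant_derivativeE (w : field1 g) i p a b : chart_dom i p ->
  covariant_derivative w i p a b =
  dform w i p a b - 2^-1 * lowered_christoffel i p (sharp i p (w i p)) a b.
Proof. by move=> ip; rewrite -christoffel_contract// !mxE. Qed.

(** The term in the second derivatives of the transition map is the same in
    [dform_change] and in the contracted Christoffel symbols, by [koszul_change]
    applied to [v := sharp i p w], for which [h *m V^T] is [w] in the other chart. *)
Lemma covariant_derivative_tensor Omega (w : field1 g) :
  open Omega -> smooth_form Omega w -> is_tensor2 Omega (covariant_derivative w).
Proof.
move=> oO sw i j p Op ip jp; have [tw _] := sw.
set J := transition_jacobian i j p.
apply/matrixP => a b; rewrite covariant_derivativeE//.
rewrite (dform_change _ _ oO sw Op ip jp) -/J.
rewrite /lowered_christoffel.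
under eq_bigr do rewrite !(dmetric_change _ ip jp).
have Ewj := tw i j p Op ip jp.
rewrite (@koszul_change _ _ J (metric j p) (transition_second i j p) (dmetric j p)); last 2 first.
- exact: Defs.metric_sym.
- by move=> c d k; exact: transition_second_sym.
rewrite (sharp_change ip jp Ewj).
have -> : metric j p *m (sharp j p (w j p))^T = w j p.
  by rewrite /sharp trmxK mulKVmx// metric_unit.
set N := \matrix_(m, k) _.
have subZ (A B : 'M[R]_n) c d : (A - 2^-1 *: B) c d = A c d - 2^-1 * B c d.
  by rewrite !mxE.
have -> : covariant_derivative w j p = dform w j p - 2^-1 *: N.
  apply/matrixP => m k; rewrite covariant_derivativeE// subZ.
  by congr (_ - _ * _); rewrite [RHS]mxE.
rewrite mulmxBr mulmxBl -scalemxAr -scalemxAl subZ.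
move: ((J *m N *m J^T) a b) ((J *m _ *m J^T) a b) ((transition_second _ _ _ _ *m _) b ord0).
by move=> s t u; clear; lra.
Qed.

End charts_calculus.

Section smooth_differential.
Variables (R : realType) (n : nat) (M : ptopologicalType) (g : riemannian R n M).
Implicit Types (i j : chart g) (p : M) (Omega U : set M).

Lemma smooth_fun_Ck k Omega f i : smooth_fun g Omega f ->
  Ck k (chart_coord i @` (chart_dom i `&` Omega)) (f \o chart_inv i).
Proof. exact. Qed.

(** Chain rule for [f \o chart_inv i = (f \o chart_inv j) \o transition i j]. *)
Lemma differential_form Omega f : open Omega -> smooth_fun g Omega f ->
  is_form Omega (differential g f).
Proof.
move=> oO sf i j p Op ip jp; apply/colP => a.
rewrite mxE [RHS]mxE.
pose D := chart_coord i @` (chart_dom i `&` (chart_dom j `&` Omega)).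
have oD : open D by apply: chart_image_open; apply: openI => //; exact: dom_open.
have Dp : D (chart_coord i p) by exists p.
have local x : D x -> (f \o chart_inv i) x = ((f \o chart_inv j) \o transition i j) x.
  move=> [q [iq [jq Oq]] <-] /=.
  by rewrite /transition (coordK iq) (coordK jq).
rewrite (partial_congr _ oD local Dp).
rewrite partial_transition//; last first.
  apply: (C1_differentiable (@chart_image_open _ _ _ _ j Omega oO)).
    exact: smooth_fun_Ck.
  by exists p.
by apply: eq_bigr => k _; rewrite [differential _ _ _ _ _ _]mxE.
Qed.

Lemma differential_smooth Omega f : open Omega -> smooth_fun g Omega f ->
  smooth_form Omega (differential g f).
Proof.
move=> oO sf; split; first exact: differential_form.
move=> i a k; apply: (@Ck_congr _ _ _ _ (partial a (f \o chart_inv i)));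
  [exact: chart_image_open| |].
  by move=> x [q [iq Oq] <-]; rewrite mxE (coordK iq).
exact: (Ck_partial _ (smooth_fun_Ck k.+1 i sf)).
Qed.

End smooth_differential.

(** * Measurability *)

Lemma open_borel (M : ptopologicalType) (U : set (borel M)) :
  open (U : set M) -> measurable U.
Proof. by move=> oU; apply: sub_sigma_algebra. Qed.

Lemma continuous_on_measurable (R : realType) (M : ptopologicalType)
    (D : set (borel M)) (f : borel M -> R) :
  open (D : set M) -> (forall p, D p -> {for p, continuous (f : M -> R)}) ->
  measurable_fun D f.
Proof.
move=> oD fc; apply: (measurability _ (measurable_realfun.RGenOpens.measurableE R)).
move=> _ [_ [a [b ->] <-]]; apply: open_borel.
rewrite openE => p [Dp fp].
apply: filterI; first by apply: open_nbhs_nbhs.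
by apply: (fc p Dp); apply: open_nbhs_nbhs; split => //; exact: interval_open.
Qed.

Lemma measurable_inv_fun d (T : measurableType d) (R : realType) (D : set T)
    (f : T -> R) :
  (forall x, D x -> f x != 0) -> measurable_fun D f ->
  measurable_fun D (fun x => (f x)^-1).
Proof.
move=> f0 mf.
have oN : open [set x : R | x != 0] by exact: open_neq.
apply: (measurable_comp (F := [set x : R | x != 0]) (f := GRing.inv)) mf.
- exact: open_measurable.
- by move=> _ [x Dx <-]; exact: f0.
- apply: open_continuous_measurable_fun => // x; rewrite inE /= => x0.
  exact: inv_continuous.
Qed.

Definition mx_measurable d (T : measurableType d) (R : realType) m n (D : set T)
  (A : T -> 'M[R]_(m, n)) := forall a b, measurable_fun D (fun p => A p a b).

Section mx_measurable.
Variables (d : measure_display) (T : measurableType d) (R : realType) (D : set T).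

Lemma mx_measurableM m n k (A : T -> 'M[R]_(m, n)) (B : T -> 'M[R]_(n, k)) :
  mx_measurable D A -> mx_measurable D B -> mx_measurable D (fun p => A p *m B p).
Proof.
move=> mA mB a b.
rewrite (_ : (fun p => _) = fun p => \sum_j A p a j * B p j b); last first.
  by apply/funext => p; rewrite mxE.
by apply: measurable_sum => j; exact: measurable_funM.
Qed.

Lemma mx_measurable_tr m n (A : T -> 'M[R]_(m, n)) :
  mx_measurable D A -> mx_measurable D (fun p => (A p)^T).
Proof.
by move=> mA a b; under eq_fun do rewrite mxE; exact: mA.
Qed.

Lemma measurable_det n (A : T -> 'M[R]_n) :
  mx_measurable D A -> measurable_fun D (fun p => \det (A p)).
Proof.
move=> mA; apply: measurable_sum => s; apply: measurable_funM.
  exact: measurable_cst.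
by apply: measurable_prod => i _; exact: mA.
Qed.

Lemma mx_measurableV n (A : T -> 'M[R]_n) : (forall p, D p -> A p \in unitmx) ->
  mx_measurable D A -> mx_measurable D (fun p => invmx (A p)).
Proof.
move=> uA mA a b.
apply: (@eq_measurable_fun _ _ _ _ _ (fun p => (\det (A p))^-1 *
    ((-1) ^+ (b + a) * \det (row' b (col' a (A p)))))).
  by move=> p /[!inE] Dp; rewrite /invmx uA// !mxE.
apply: measurable_funM.
  apply: measurable_inv_fun; last exact: measurable_det.
  by move=> p Dp; rewrite -unitfE -unitmxE uA.
apply: measurable_funM; first exact: measurable_cst.
by apply: measurable_det => c e; under eq_fun do rewrite !mxE; exact: mA.
Qed.

Lemma measurable_tr n (A : T -> 'M[R]_n) :
  mx_measurable D A -> measurable_fun D (fun p => \tr (A p)).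
Proof. by move=> mA; apply: measurable_sum => a; exact: mA. Qed.

End mx_measurable.

Section measurability.
Variables (R : realType) (n : nat) (M : ptopologicalType) (g : riemannian R n M).
Implicit Types (i j : chart g) (p : M) (Omega U : set M).

(** There may be uncountably many charts, but the members of a countable base that
    lie in the domain of some chart already cover the manifold. *)
Lemma measurable_from_charts Omega (F : borel M -> R) :
  (forall i, measurable_fun ((chart_dom i `&` Omega) : set (borel M)) F) ->
  (forall i, measurable ((chart_dom i `&` Omega) : set (borel M))) ->
  measurable_fun (Omega : set (borel M)) F.
Proof.
move=> mF mO _ Y mY.
have [B cB [oB bB]] := manifold_second_countable g.
have /countable_injP[f finj] := cB.
pose S := (Omega : set (borel M)) `&` F @^-1` Y.
pose B' U := B U /\ exists i, U `<=` chart_dom (r := g) i.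
rewrite (_ : _ `&` _ = \bigcup_(k : nat) [set p | exists U, [/\ B' U, f U = k & (U `&` S) p]]).
  apply: bigcupT_measurable => k.
  have [[U0 [B'U0 fU0]]|nU] := pselect (exists U, B' U /\ f U = k).
    rewrite (_ : mkset _ = U0 `&` S).
      have [BU0 [i iU0]] := B'U0.
      rewrite (_ : U0 `&` S = U0 `&` (((chart_dom i `&` Omega) : set (borel M)) `&` F @^-1` Y)).
        by apply: measurableI; [apply: open_borel; exact: (oB _ BU0) | exact: (mF i (mO i) Y mY)].
      apply/seteqP; split=> p [Up]; first by move=> [Op Yp]; do !split => //; exact: iU0.
      by move=> [[ip Op] Yp].
    apply/seteqP; split=> p /=; last by move=> USp; exists U0.
    move=> [U [B'U fU]]; suff -> : U = U0 by [].
    apply: finj; rewrite ?inE; [exact: B'U.1|exact: B'U0.1|by rewrite fU fU0].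
  rewrite (_ : mkset _ = set0); first exact: measurable0.
  by apply/seteqP; split=> p //= [U [B'U fU _]]; case: nU; exists U.
apply/seteqP; split=> p /=; last by move=> [k _ [U [_ _ []]]].
move=> Sp; have := bB p (chart_dom (chart_at g p)).
have nd : nbhs p (chart_dom (chart_at g p)).
  by apply: open_nbhs_nbhs; split; [exact: dom_open | exact: dom_chart_at].
move=> /(_ nd)[U /= [BU Up] Usub].
exists (f U) => //; exists U; split => //.
by split => //; exists (chart_at g p).
Qed.

Lemma chart_set_open Omega i : open Omega -> open (chart_dom i `&` Omega).
Proof. by move=> oO; apply: openI => //; exact: dom_open. Qed.

Lemma chart_set_measurable Omega i : open Omega ->
  measurable ((chart_dom i `&` Omega) : set (borel M)).
Proof. by move=> oO; apply: open_borel; exact: chart_set_open. Qed.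

Lemma measurable_in_chart Omega i (f : 'rV[R]_n -> R) : open Omega ->
  (forall x, (chart_coord i @` (chart_dom i `&` Omega)) x -> {for x, continuous f}) ->
  measurable_fun ((chart_dom i `&` Omega) : set (borel M))
    (fun p : borel M => f (chart_coord i p)).
Proof.
move=> oO fc; apply: continuous_on_measurable; first exact: chart_set_open.
move=> p [ip Op]; apply: (@continuous_comp _ _ _ (chart_coord i) f).
  exact: Defs.coord_continuous.
by apply: fc; exists p.
Qed.

Lemma metric_measurable Omega i : open Omega ->
  mx_measurable ((chart_dom i `&` Omega) : set (borel M)) (fun p : borel M => metric i p).
Proof.
move=> oO a b.
apply: (@eq_measurable_fun _ _ _ _ _
  (fun p : borel M => metric i (chart_inv i (chart_coord i p)) a b)).
  by move=> p; rewrite inE => -[ip _]; rewrite (coordK ip).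
apply: (@measurable_in_chart _ i (fun x => metric i (chart_inv i x) a b)) => //.
move=> _ [q [iq _] <-].
apply: (Ck_continuous (metric_smooth (r := g) i a b 0)).
by exists q.
Qed.

Lemma metric_inv_measurable Omega i : open Omega ->
  mx_measurable ((chart_dom i `&` Omega) : set (borel M))
    (fun p : borel M => invmx (metric i p)).
Proof.
move=> oO; apply: mx_measurableV; last exact: metric_measurable.
by move=> p [ip _]; exact: metric_unit.
Qed.

Lemma dmetric_measurable Omega i c : open Omega ->
  mx_measurable ((chart_dom i `&` Omega) : set (borel M))
    (fun p : borel M => dmetric i p c).
Proof.
move=> oO a b; under eq_fun do rewrite dmetricE.
apply: (@measurable_in_chart _ i
  (fun x => partial c (fun x => metric i (chart_inv i x) a b) x)) => //.
move=> _ [q [iq _] <-].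
apply: (Ck_continuous (Ck_partial _ (metric_smooth (r := g) i a b 1))).
by exists q.
Qed.

Lemma smooth_form_measurable Omega (w : field1 g) : open Omega ->
  smooth_form Omega w -> measurable_form Omega w.
Proof.
move=> oO [_ sw] i a.
apply: (@eq_measurable_fun _ _ _ _ _
  (fun p : borel M => w i (chart_inv i (chart_coord i p)) a ord0)).
  by move=> p; rewrite inE => -[ip _]; rewrite (coordK ip).
apply: (@measurable_in_chart _ i (fun x => w i (chart_inv i x) a ord0)) => //.
by move=> x Dx; exact: (Ck_continuous (sw i a 0) Dx).
Qed.

Lemma smooth_fun_measurable Omega (f : M -> R) : open Omega ->
  smooth_fun g Omega f -> measurable_fun (Omega : set (borel M)) (f : borel M -> R).
Proof.
move=> oO sf; apply: measurable_from_charts; last first.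
  by move=> i; exact: chart_set_measurable.
move=> i; apply: (@eq_measurable_fun _ _ _ _ _
  (fun p : borel M => (f \o chart_inv i) (chart_coord i p))).
  by move=> p; rewrite inE => -[ip _] /=; rewrite (coordK ip).
apply: (@measurable_in_chart _ i (f \o chart_inv i)) => //.
by move=> x Dx; exact: (Ck_continuous (sf i 0) Dx).
Qed.

(** In a chart the components are polynomials in continuous functions and in the
    entries of the inverse metric. *)
Lemma covariant_derivative_measurable Omega (w : field1 g) : open Omega ->
  smooth_form Omega w -> measurable_tensor2 Omega (covariant_derivative w).
Proof.
move=> oO sw i a b; have [_ sw'] := sw.
have mw := smooth_form_measurable oO sw.
apply: (@eq_measurable_fun _ _ _ _ _ (fun p : borel M => dform w i p a b -
    2^-1 * \sum_d (\sum_c invmx (metric i p) d c * w i p c ord0) *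
      (dmetric i p a b d + dmetric i p b a d - dmetric i p d a b))).
  move=> p; rewrite inE => -[ip _]; rewrite (covariant_derivativeE _ _ _ ip).
  congr (_ - _ * _); apply: eq_bigr => d _; congr (_ * _).
  by rewrite /sharp [RHS]mxE [RHS]mxE.
apply: measurable_funB.
  apply: (@eq_measurable_fun _ _ _ _ _ (fun p : borel M =>
    partial a (fun x => w i (chart_inv i x) b ord0) (chart_coord i p))).
    by move=> p _; rewrite [RHS]mxE.
  apply: (@measurable_in_chart _ i (partial a (fun x => w i (chart_inv i x) b ord0))) => //.
  by move=> x Dx; exact: (Ck_continuous (Ck_partial _ (sw' i b 1)) Dx).
apply: measurable_funM; first exact: measurable_cst.
apply: measurable_sum => d; apply: measurable_funM.
  apply: measurable_sum => c; apply: measurable_funM; last exact: mw.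
  exact: metric_inv_measurable.
apply: measurable_funB; last exact: dmetric_measurable.
by apply: measurable_funD; exact: dmetric_measurable.
Qed.

Lemma tensor2_norm_sq_measurable Omega (T : field2 g) : open Omega ->
  is_tensor2 Omega T -> measurable_tensor2 Omega T ->
  measurable_fun (Omega : set (borel M)) (tensor2_norm_sq T : borel M -> R).
Proof.
move=> oO tT mT; apply: measurable_from_charts; last first.
  by move=> i; exact: chart_set_measurable.
move=> i; apply: (@eq_measurable_fun _ _ _ _ _ (fun p : borel M => tensor_nsq i p (T i p))).
  by move=> p; rewrite inE => -[ip Op]; rewrite (tensor_nsq_at tT Op ip).
have mI := metric_inv_measurable (i := i) oO.
have mTi : mx_measurable ((chart_dom i `&` Omega) : set (borel M)) (fun p : borel M => T i p).
  by move=> a b; exact: mT.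
apply: measurable_tr; apply: mx_measurableM; last exact: mx_measurable_tr.
by apply: mx_measurableM => //; exact: mx_measurableM.
Qed.

Lemma form_norm_sq_measurable Omega (w : field1 g) : open Omega ->
  is_form Omega w -> measurable_form Omega w ->
  measurable_fun (Omega : set (borel M)) (form_norm_sq w : borel M -> R).
Proof.
move=> oO tw mw; apply: measurable_from_charts; last first.
  by move=> i; exact: chart_set_measurable.
move=> i; apply: (@eq_measurable_fun _ _ _ _ _ (fun p : borel M => covector_nsq i p (w i p))).
  by move=> p; rewrite inE => -[ip Op]; rewrite (covector_nsq_at tw Op ip).
have mI := metric_inv_measurable (i := i) oO.
have mwi : mx_measurable ((chart_dom i `&` Omega) : set (borel M)) (fun p : borel M => w i p).
  by move=> a b; rewrite (ord1 b); exact: mw.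
suff H : mx_measurable ((chart_dom i `&` Omega) : set (borel M))
    (fun p : borel M => (w i p)^T *m invmx (metric i p) *m w i p) by exact: H.
by apply: mx_measurableM => //; apply: mx_measurableM => //; exact: mx_measurable_tr.
Qed.

End measurability.

(** * Integrals and the H^2 norm *)

(** The integral of a nonnegative function is a supremum over the simple functions
    below it, so it is monotone without measurability.  In this form it applies to
    the Ricci term, which is evaluated in the chart [chart_at g p]. *)
Lemma ge0_le_integral_nonmeasurable d (T : measurableType d) (R : realType)
    (mu : {measure set T -> \bar R}) (D : set T) (f1 f2 : T -> \bar R) :
  (forall x, D x -> 0 <= f1 x)%E -> (forall x, D x -> f1 x <= f2 x)%E ->
  (\int[mu]_(x in D) f1 x <= \int[mu]_(x in D) f2 x)%E.
Proof.
move=> f10 f12.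
have f20 x : D x -> (0 <= f2 x)%E by move=> Dx; apply: le_trans (f12 x Dx); exact: f10.
rewrite !ge0_integralE//; apply: le_ereal_sup => _ [h /= hf <-]; exists h => //= x.
apply: le_trans (hf x) _; rewrite /patch; case: ifPn => //; rewrite inE.
exact: f12.
Qed.

Section sobolev.
Variables (R : realType) (n : nat) (M : ptopologicalType) (g : riemannian R n M).
Variables (dv : {measure set (borel M) -> \bar R}) (Omega : set M).
Hypothesis oO : open Omega.
Local Notation I := (integral_Omega dv Omega).
Implicit Types (F G : M -> R) (p : M).

Lemma Omega_measurable : measurable (Omega : set (borel M)).
Proof. exact: open_borel. Qed.

Lemma integral_Omega_ext F G : (forall p, Omega p -> F p = G p) -> I F = I G.
Proof. by move=> FG; apply: eq_integral => p; rewrite inE => Op; rewrite FG. Qed.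

Lemma integral_Omega_ge0 F : (forall p, 0 <= F p) -> (0 <= I F)%E.
Proof. by move=> F0; apply: integral_ge0 => p _; rewrite lee_fin. Qed.

Lemma integral_Omega_le F G : (forall p, 0 <= F p) ->
  (forall p, Omega p -> F p <= G p) -> (I F <= I G)%E.
Proof.
move=> F0 FG; apply: ge0_le_integral_nonmeasurable => p Op; rewrite lee_fin//.
exact: FG.
Qed.

Lemma integral_OmegaD F G : (forall p, 0 <= F p) -> (forall p, 0 <= G p) ->
  measurable_fun (Omega : set (borel M)) (F : borel M -> R) ->
  measurable_fun (Omega : set (borel M)) (G : borel M -> R) ->
  I (fun p => F p + G p) = (I F + I G)%E.
Proof.
move=> F0 G0 mF mG; rewrite /integral_Omega -ge0_integralD//.
- exact: Omega_measurable.
- by move=> p _; rewrite lee_fin.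
- exact/measurable_EFinP.
- by move=> p _; rewrite lee_fin.
- exact/measurable_EFinP.
Qed.

Lemma integral_OmegaZ (c : R) F : 0 <= c -> (forall p, 0 <= F p) ->
  measurable_fun (Omega : set (borel M)) (F : borel M -> R) ->
  I (fun p => c * F p) = (c%:E * I F)%E.
Proof.
move=> c0 F0 mF; rewrite /integral_Omega -ge0_integralZl//.
- exact: Omega_measurable.
- exact/measurable_EFinP.
- by move=> p _; rewrite lee_fin.
Qed.

Lemma form_norm_sq_ge0 (w : field1 g) p : 0 <= form_norm_sq w p.
Proof. by rewrite form_norm_sqE; apply: covector_nsq_ge0; exact: dom_chart_at. Qed.

Lemma tensor2_norm_sq_ge0 (T : field2 g) p : 0 <= tensor2_norm_sq T p.
Proof. by apply: (@tensor_nsq_ge0 _ _ _ g (chart_at g p)); exact: dom_chart_at. Qed.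

Lemma form_norm_sq_lin_le (c : R) (w w' : field1 g) p :
  form_norm_sq (c *: w + w') p <=
  2 * c ^+ 2 * form_norm_sq w p + 2 * form_norm_sq w' p.
Proof. by rewrite !form_norm_sqE; apply: covector_nsq_lin_le; exact: dom_chart_at. Qed.

Lemma tensor2_norm_sq_lin_le (c : R) (T T' : field2 g) p :
  tensor2_norm_sq (c *: T + T') p <=
  2 * c ^+ 2 * tensor2_norm_sq T p + 2 * tensor2_norm_sq T' p.
Proof. by apply: (@tensor_nsq_lin_le _ _ _ g (chart_at g p)); exact: dom_chart_at. Qed.

Lemma form_norm_sqZ (c : R) (w : field1 g) p :
  form_norm_sq (c *: w) p = c ^+ 2 * form_norm_sq w p.
Proof. by rewrite !form_norm_sqE; exact: covector_nsqZ. Qed.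

Lemma tensor2_norm_sqZ (c : R) (T : field2 g) p :
  tensor2_norm_sq (c *: T) p = c ^+ 2 * tensor2_norm_sq T p.
Proof. exact: (tensor_nsqZ (chart_at g p) p c). Qed.

(** The part of the definition of [sobolev_H2] that does not mention approximation;
    it is what makes [H2_density] measurable. *)
Definition H2_regular (u : H2_space g) :=
  [/\ measurable_fun (Omega : set (borel M)) (u.1.1 : borel M -> R),
      is_form Omega u.1.2, measurable_form Omega u.1.2,
      is_tensor2 Omega u.2 & measurable_tensor2 Omega u.2].

Lemma H2_regular_lin (c : R) (u v : H2_space g) :
  H2_regular u -> H2_regular v -> H2_regular (c *: u + v).
Proof.
move=> [u1 u2 u3 u4 u5] [v1 v2 v3 v4 v5]; split => /=.
- by apply: measurable_funD => //; apply: measurable_funM => //; exact: measurable_cst.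
- move=> i j p Op ip jp; rewrite !fctE.
  by rewrite (u2 i j p Op ip jp) (v2 i j p Op ip jp) mulmxDr scalemxAr.
- move=> i a; apply: (@eq_measurable_fun _ _ _ _ _
    (fun p : borel M => c * u.1.2 i p a ord0 + v.1.2 i p a ord0)).
    by move=> p _; rewrite !fctE [RHS]mxE [in RHS]mxE.
  by apply: measurable_funD => //; apply: measurable_funM => //; exact: measurable_cst.
- move=> i j p Op ip jp; rewrite !fctE.
  rewrite (u4 i j p Op ip jp) (v4 i j p Op ip jp) mulmxDr mulmxDl.
  by rewrite -scalemxAr -scalemxAl.
- move=> i a b; apply: (@eq_measurable_fun _ _ _ _ _
    (fun p : borel M => c * u.2 i p a b + v.2 i p a b)).
    by move=> p _; rewrite !fctE [RHS]mxE [in RHS]mxE.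
  by apply: measurable_funD => //; apply: measurable_funM => //; exact: measurable_cst.
Qed.

Lemma H2_regular_jet (f : M -> R) : smooth_fun g Omega f -> H2_regular (H2_jet g f).
Proof.
move=> sf; have sw := differential_smooth oO sf; split => /=.
- exact: smooth_fun_measurable.
- by case: sw.
- exact: smooth_form_measurable.
- exact: covariant_derivative_tensor.
- exact: covariant_derivative_measurable.
Qed.

Definition H2_density (u : H2_space g) (p : M) : R :=
  tensor2_norm_sq u.2 p + form_norm_sq u.1.2 p + (u.1.1 p) ^+ 2.

Lemma H2_density_ge0 u p : 0 <= H2_density u p.
Proof.
by rewrite !addr_ge0 ?sqr_ge0 ?form_norm_sq_ge0 ?tensor2_norm_sq_ge0.
Qed.

Lemma H2_density_lin_le (c : R) u v p :
  H2_density (c *: u + v) p <= 2 * c ^+ 2 * H2_density u p + 2 * H2_density v p.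
Proof.
have H1 := tensor2_norm_sq_lin_le c u.2 v.2 p.
have H2 := form_norm_sq_lin_le c u.1.2 v.1.2 p.
have H3 := sqr_lin_le c (u.1.1 p) (v.1.1 p).
have E : H2_density (c *: u + v) p = tensor2_norm_sq (c *: u.2 + v.2) p +
    form_norm_sq (c *: u.1.2 + v.1.2) p + (c * u.1.1 p + v.1.1 p) ^+ 2 := erefl.
rewrite E; apply: (le_trans (lerD (lerD H1 H2) H3)); rewrite /H2_density.
move: (tensor2_norm_sq u.2 p) (form_norm_sq u.1.2 p) (u.1.1 p ^+ 2).
move: (tensor2_norm_sq v.2 p) (form_norm_sq v.1.2 p) (v.1.1 p ^+ 2).
move: (2 * c ^+ 2) => k *; rewrite le_eqVlt; apply/orP; left; apply/eqP; ring.
Qed.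

Lemma H2_density_measurable u : H2_regular u ->
  measurable_fun (Omega : set (borel M)) (H2_density u : borel M -> R).
Proof.
move=> [u1 u2 u3 u4 u5]; apply: measurable_funD; last exact: measurable_funX.
apply: measurable_funD; first exact: tensor2_norm_sq_measurable.
exact: form_norm_sq_measurable.
Qed.

(** Parallelogram estimate; splitting the integral is where measurability of both
    densities is used. *)
Lemma H2_norm_sq_lin_le (c : R) u v : H2_regular u -> H2_regular v ->
  (H2_norm_sq dv Omega (c *: u + v) <=
   (2 * c ^+ 2)%:E * H2_norm_sq dv Omega u + 2%:E * H2_norm_sq dv Omega v)%E.
Proof.
move=> Fu Fv; have mu := H2_density_measurable Fu; have mv := H2_density_measurable Fv.
have c0 : 0 <= 2 * c ^+ 2 by rewrite mulr_ge0 ?sqr_ge0.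
rewrite /H2_norm_sq -(integral_OmegaZ c0 (H2_density_ge0 u))//.
rewrite -(integral_OmegaZ _ (H2_density_ge0 v))// -integral_OmegaD.
- by apply: integral_Omega_le => p; [exact: H2_density_ge0 | move=> _; exact: H2_density_lin_le].
- by move=> p; rewrite mulr_ge0// H2_density_ge0.
- by move=> p; rewrite mulr_ge0// H2_density_ge0.
- by apply: measurable_funM => //; exact: measurable_cst.
- by apply: measurable_funM => //; exact: measurable_cst.
Qed.

Lemma smooth_fun_lin (c : R) (f h : M -> R) : smooth_fun g Omega f ->
  smooth_fun g Omega h -> smooth_fun g Omega (fun p => c * f p + h p).
Proof.
move=> sf sh i k; apply: (@Ck_lin _ _ k _ c (f \o chart_inv i) (h \o chart_inv i)).
- exact: chart_image_open.
- exact: sf.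
- exact: sh.
Qed.

Lemma differential_lin (c : R) (f h : M -> R) i p : smooth_fun g Omega f ->
  smooth_fun g Omega h -> Omega p -> chart_dom i p ->
  differential g (fun p => c * f p + h p) i p =
  c *: differential g f i p + differential g h i p.
Proof.
move=> sf sh Op ip; apply/colP => a; rewrite mxE [RHS]mxE [X in X + _]mxE.
rewrite [differential g f i p a ord0]mxE [differential g h i p a ord0]mxE.
have Dp : (chart_coord i @` (chart_dom i `&` Omega)) (chart_coord i p) by exists p.
apply: (@partial_lin _ _ c (f \o chart_inv i) (h \o chart_inv i)).
  exact: (Ck_derivable (smooth_fun_Ck 1 i sf) Dp).
exact: (Ck_derivable (smooth_fun_Ck 1 i sh) Dp).
Qed.

Lemma hessian_lin (c : R) (f h : M -> R) i p : smooth_fun g Omega f ->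
  smooth_fun g Omega h -> Omega p -> chart_dom i p ->
  hessian g (fun p => c * f p + h p) i p =
  c *: hessian g f i p + hessian g h i p.
Proof.
move=> sf sh Op ip; apply/matrixP => a b.
have addE m (A B : 'M[R]_(n, m)) d e : (c *: A + B) d e = c * A d e + B d e.
  by rewrite !mxE.
have hessianE (f' : M -> R) : hessian g f' i p a b =
    partial a (fun x => differential g f' i (chart_inv i x) b ord0) (chart_coord i p)
    - \sum_e christoffel i e a b (chart_coord i p) * differential g f' i p e ord0.
  by rewrite [LHS]mxE.
rewrite addE !hessianE (differential_lin c sf sh Op ip).
pose D := chart_coord i @` (chart_dom i `&` Omega).
have oD : open D by exact: chart_image_open.
have Dp : D (chart_coord i p) by exists p.
have [_ sdf] := differential_smooth oO sf.
have [_ sdh] := differential_smooth oO sh.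
have local x : D x -> differential g (fun p => c * f p + h p) i (chart_inv i x) b ord0 =
    c * differential g f i (chart_inv i x) b ord0 + differential g h i (chart_inv i x) b ord0.
  move=> [q [iq Oq] <-]; rewrite (coordK iq) (differential_lin c sf sh Oq iq).
  by rewrite addE.
rewrite (partial_congr _ oD local Dp) partial_lin; last 2 first.
- exact: (Ck_derivable (sdf i b 1) Dp).
- exact: (Ck_derivable (sdh i b 1) Dp).
rewrite mulrBr mulr_sumr [RHS]addrACA; congr (_ + _).
rewrite -opprD -big_split /=; congr (- _); apply: eq_bigr => e _.
by rewrite addE mulrDr mulrCA.
Qed.

(** Jets are linear only on [Omega], where the functions are differentiable, so the
    approximation errors are compared there. *)
Lemma H2_density_jet_lin (c : R) (f h : M -> R) u v p :
  smooth_fun g Omega f -> smooth_fun g Omega h -> Omega p ->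
  H2_density (H2_jet g (fun p => c * f p + h p) - (c *: u + v)) p =
  H2_density (c *: (H2_jet g f - u) + (H2_jet g h - v)) p.
Proof.
move=> sf sh Op; rewrite /H2_density /tensor2_norm_sq /form_norm_sq /=.
have ap := dom_chart_at g p.
rewrite !fctE (differential_lin c sf sh Op ap) (hessian_lin c sf sh Op ap).
have E (V : lmodType R) (x y x' y' : V) :
    c *: x + y - (c *: x' + y') = c *: (x - x') + (y - y').
  by rewrite scalerBr opprD addrACA.
by rewrite !E; congr (_ + _ ^+ 2); rewrite mulrBr opprD addrACA.
Qed.

End sobolev.

(** * Min-max values *)

(** The factor may be infinite: if [eta_1] is, one positive element of [A] already
    forces [s] to be infinite. *)
Lemma ereal_sup_mul_le (R : realType) (c : \bar R) (A : set (\bar R)) (s : \bar R) :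
  (0 <= c)%E -> (0 <= s)%E -> (forall x, A x -> (c * x <= s)%E) ->
  (c * ereal_sup A <= s)%E.
Proof.
move=> c0 s0 cA; case: c c0 cA => [c| |] c0 cA //.
  have [->|cn0] := eqVneq c 0; first by rewrite mul0e.
  have cp : 0 < c by rewrite lt_def cn0 -lee_fin.
  by rewrite -lee_pdivlMl//; apply: ge_ereal_sup => x Ax; rewrite lee_pdivlMl//; exact: cA.
have [[x [Ax x0]]|An] := pselect (exists x, A x /\ (0 < x)%E).
  by have := cA x Ax; rewrite gt0_mulye// leye_eq => /eqP ->; rewrite leey.
apply: (@le_trans _ _ 0%E) => //; apply: mule_ge0_le0 => //.
apply: ge_ereal_sup => x Ax; rewrite leNgt; apply/negP => x0.
by apply: An; exists x.
Qed.

(** For [y = 0] and [y = +oo] both sides are multiples of [+oo] and of [0]. *)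
Lemma dive_pscale (R : realType) (k : R) (x y : \bar R) : 0 < k -> (0 <= y)%E ->
  ((k%:E * x) / (k%:E * y) = x / y)%E.
Proof.
move=> k0; case: y => [y| |]// y0.
  have [->|yn0] := eqVneq y 0.
    by rewrite mule0 inve0 -muleA muleCA gt0_muley ?lte_fin.
  rewrite -EFinM !inver mulf_eq0 gt_eqF//= (negbTE yn0) invfM EFinM.
  by rewrite muleACA -EFinM mulfV ?gt_eqF// mul1e.
by rewrite gt0_muley ?lte_fin// invey !mule0.
Qed.

Section minmax_facts.
Variables (R : realType) (V : lmodType R) (E : set V) (nsq num den : V -> \bar R).
Hypothesis num0 : forall u, (0 <= num u)%E.
Hypothesis den0 : forall u, (0 <= den u)%E.

Lemma quotient_ge0 u : (0 <= num u / den u)%E.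
Proof. by rewrite mule_ge0// inve_ge0. Qed.

(** The supremum is over a nonempty set: the sum of the basis vectors is not null. *)
Lemma span_sup_ge0 j (b : 'I_j -> V) : (0 < j)%N ->
  (forall c : 'I_j -> R, nsq (\sum_i c i *: b i) = 0%E -> forall i, c i = 0) ->
  (0 <= ereal_sup [set (num u / den u)%E | u in
         [set u | (exists c : 'I_j -> R, u = (\sum_i c i *: b i)%R) /\ nsq u <> 0%E]])%E.
Proof.
case: j b => // j b _ indep.
apply: le_ereal_sup_tmp; pose u := \sum_i (fun=> 1) i *: b i.
exists (num u / den u)%E; last exact: quotient_ge0.
exists u => //; split; first by exists (fun=> 1).
by move=> /indep/(_ ord0)/eqP; rewrite oner_eq0.
Qed.

Lemma minmax_ge0 j : (0 < j)%N -> (0 <= minmax E nsq num den j)%E.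
Proof.
by move=> j0; apply: le_ereal_inf_tmp => _ [b [_ indep] <-]; exact: span_sup_ge0.
Qed.

(** Every nonnull vector of the line spanned by [w] has the same quotient. *)
Lemma minmax1_le w :
  (forall c, nsq (c *: w) = ((c ^+ 2)%:E * nsq w)%E) ->
  (forall c, num (c *: w) = ((c ^+ 2)%:E * num w)%E) ->
  (forall c, den (c *: w) = ((c ^+ 2)%:E * den w)%E) ->
  E w -> nsq w <> 0%E -> (minmax E nsq num den 1 <= num w / den w)%E.
Proof.
move=> nsqZ numZ denZ Ew nw.
apply: ge_ereal_inf; eexists; first by exists (fun=> w); [|reflexivity];
  split=> // c; rewrite big_ord1 nsqZ => /eqP; rewrite mule_eq0 => /orP[|/eqP//];
  rewrite eqe sqrf_eq0 => /eqP c0 i; rewrite (ord1 i).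
apply: ge_ereal_sup => _ [_ [[c ->] nu] <-]; rewrite big_ord1.
have c0 : c ord0 != 0.
  by apply/eqP => c0; apply: nu; rewrite big_ord1 nsqZ c0 expr0n mul0e.
by rewrite numZ denZ dive_pscale// exprn_even_gt0.
Qed.

End minmax_facts.

(** * Comparison of the eigenvalues *)

Section sobolev_spaces.
Variables (R : realType) (n : nat) (M : ptopologicalType) (g : riemannian R n M).
Variables (dv : {measure set (borel M) -> \bar R}) (Omega : set M).
Hypothesis oO : open Omega.
Local Notation I := (integral_Omega dv Omega).
Local Notation H2 := (sobolev_H2 (g := g) dv Omega).
Local Notation N2 := (H2_norm_sq (g := g) dv Omega).
Implicit Types (u v : H2_space g) (w : H1form_space g) (c : R).

Lemma H2_norm_sq_jet_lin c (f h : M -> R) u v :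
  smooth_fun g Omega f -> smooth_fun g Omega h ->
  N2 (H2_jet g (fun p => c * f p + h p) - (c *: u + v)) =
  N2 (c *: (H2_jet g f - u) + (H2_jet g h - v)).
Proof.
move=> sf sh; apply: integral_Omega_ext => p Op.
exact: (H2_density_jet_lin oO c u v sf sh Op).
Qed.

Lemma H2_norm_sq_ge0 u : (0 <= N2 u)%E.
Proof. by apply: integral_Omega_ge0 => p; exact: H2_density_ge0. Qed.

Lemma H2_regular_jetB (f : M -> R) u : smooth_fun g Omega f -> H2_regular Omega u ->
  H2_regular Omega (H2_jet g f - u).
Proof.
move=> sf Fu; rewrite addrC -scaleN1r.
by apply: H2_regular_lin => //; exact: H2_regular_jet.
Qed.

(** The combination of the approximating sequences approximates, since the error is
    bounded by [H2_norm_sq_lin_le]. *)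
Lemma sobolev_H2_lin c u v : H2 u -> H2 v -> H2 (c *: u + v).
Proof.
move=> [Fu [f [sf fu]]] [Fv [h [sh hv]]].
split; first exact: (H2_regular_lin c Fu Fv).
exists (fun k p => c * f k p + h k p); split.
  move=> k; have [sfk ffk] := sf k; have [shk fhk] := sh k.
  split; first exact: smooth_fun_lin.
  have := H2_norm_sq_jet_lin c 0 0 sfk shk.
  rewrite scaler0 addr0 !subr0 => ->.
  apply: (le_lt_trans (H2_norm_sq_lin_le dv oO c (H2_regular_jet oO sfk) (H2_regular_jet oO shk))).
  have c0 : (0 <= (2 * c ^+ 2)%:E)%E by rewrite lee_fin mulr_ge0 ?sqr_ge0.
  have two0 : (0 <= 2%:E :> \bar R)%E by rewrite lee_fin.
  by apply: lte_add_pinfty; [exact: lte_mul_pinfty c0 _ ffk | exact: lte_mul_pinfty two0 _ fhk].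
pose B k := ((2 * c ^+ 2)%:E * N2 (H2_jet g (f k) - u) + 2%:E * N2 (H2_jet g (h k) - v))%E.
have B0 : B k @[k --> \oo] --> 0%E.
  suff : B k @[k --> \oo] --> ((2 * c ^+ 2)%:E * 0 + 2%:E * 0)%E by rewrite !mule0 adde0.
  apply: cvgeD; first by rewrite !mule0.
    by apply: cvgeZl; [by []|exact: fu].
  by apply: cvgeZl; [by []|exact: hv].
apply: (squeeze_cvge _ (cvg_cst 0%E) B0); apply: nearW => k.
have [sfk _] := sf k; have [shk _] := sh k.
rewrite H2_norm_sq_ge0 H2_norm_sq_jet_lin//=.
by apply: H2_norm_sq_lin_le => //; exact: H2_regular_jetB.
Qed.

Lemma sobolev_H2_span j (b : 'I_j -> H2_space g) (c : 'I_j -> R) : (0 < j)%N ->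
  (forall i, H2 (b i)) -> H2 (\sum_i c i *: b i).
Proof.
case: j b c => // j b c _ Hb.
have H0 : H2 0.
  by rewrite -(addNr (b ord0)) -scaleN1r; exact: sobolev_H2_lin.
apply: (big_rec H2 H0) => i u _ Hu; exact: (sobolev_H2_lin (c i) (Hb i) Hu).
Qed.

Lemma H1_norm_sq_le u : (H1_norm_sq dv Omega u.1 <= N2 u)%E.
Proof.
apply: integral_Omega_le => p.
  by rewrite addr_ge0 ?sqr_ge0 ?form_norm_sq_ge0.
by move=> _; rewrite lerD2r lerDr tensor2_norm_sq_ge0.
Qed.

Lemma H1form_norm_sq_le u :
  (H1form_norm_sq dv Omega ((u.1.2, u.2) : H1form_space g) <= N2 u)%E.
Proof.
apply: integral_Omega_le => p.
  by rewrite addr_ge0 ?form_norm_sq_ge0 ?tensor2_norm_sq_ge0.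
by move=> _; rewrite lerDl sqr_ge0.
Qed.

Lemma H1_norm_sq_ge0 (u : H1_space g) : (0 <= H1_norm_sq dv Omega u)%E.
Proof.
by apply: integral_Omega_ge0 => p; rewrite addr_ge0 ?sqr_ge0 ?form_norm_sq_ge0.
Qed.

Lemma H1form_norm_sq_ge0 w : (0 <= H1form_norm_sq dv Omega w)%E.
Proof.
apply: integral_Omega_ge0 => p.
by rewrite addr_ge0 ?form_norm_sq_ge0 ?tensor2_norm_sq_ge0.
Qed.

Lemma sobolev_H2_H1 u : H2 u -> sobolev_H1 (g := g) dv Omega u.1.
Proof.
move=> [[u1 u2 u3 u4 u5] [f [sf fu]]]; split; first by split.
exists f; split.
  move=> k; have [sfk ffk] := sf k; split=> //.
  exact: le_lt_trans (H1_norm_sq_le (H2_jet g (f k))) ffk.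
apply: (squeeze_cvge _ (cvg_cst 0%E) fu); apply: nearW => k.
by rewrite H1_norm_sq_ge0 /=; exact: (H1_norm_sq_le (H2_jet g (f k) - u)).
Qed.

(** The differentials of the functions that approximate [u] approximate the pair
    [(du, D^2 u)]. *)
Lemma sobolev_H2_H1form u : H2 u ->
  sobolev_H1form dv Omega ((u.1.2, u.2) : H1form_space g).
Proof.
move=> [[u1 u2 u3 u4 u5] [f [sf fu]]]; split; first by split.
exists (fun k => differential g (f k)); split.
  move=> k; have [sfk ffk] := sf k; split; first exact: differential_smooth.
  exact: le_lt_trans (H1form_norm_sq_le (H2_jet g (f k))) ffk.
apply: (squeeze_cvge _ (cvg_cst 0%E) fu); apply: nearW => k.
by rewrite H1form_norm_sq_ge0 /=; exact: (H1form_norm_sq_le (H2_jet g (f k) - u)).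
Qed.

Lemma rough_eigenvalue_ge0 : (0 <= rough_neumann_eigenvalue g dv Omega 1)%E.
Proof.
apply: minmax_ge0 => // w; apply: integral_Omega_ge0 => p.
  exact: tensor2_norm_sq_ge0.
exact: form_norm_sq_ge0.
Qed.

(** The product form of the Rayleigh bound, valid also when the norm of the form is
    [0], and when it is [+oo], in which case the quotient is [0] and so is [eta_1]. *)
Lemma rough_eigenvalue_le w : sobolev_H1form dv Omega w ->
  (rough_neumann_eigenvalue g dv Omega 1 * I (form_norm_sq w.1)
   <= I (tensor2_norm_sq w.2))%E.
Proof.
move=> Hw; have [[w1 w2 w3 w4] _] := Hw.
have mW := form_norm_sq_measurable oO w1 w2.
have mT := tensor2_norm_sq_measurable oO w3 w4.
have W0 := integral_Omega_ge0 dv Omega (form_norm_sq_ge0 w.1).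
have T0 := integral_Omega_ge0 dv Omega (tensor2_norm_sq_ge0 w.2).
have numZ c : I (tensor2_norm_sq (c *: w).2) = ((c ^+ 2)%:E * I (tensor2_norm_sq w.2))%E.
  rewrite -integral_OmegaZ ?sqr_ge0//; last exact: tensor2_norm_sq_ge0.
  by apply: integral_Omega_ext => p _; exact: tensor2_norm_sqZ.
have denZ c : I (form_norm_sq (c *: w).1) = ((c ^+ 2)%:E * I (form_norm_sq w.1))%E.
  rewrite -integral_OmegaZ ?sqr_ge0//; last exact: form_norm_sq_ge0.
  by apply: integral_Omega_ext => p _; exact: form_norm_sqZ.
have nsqE w' : is_form Omega w'.1 -> measurable_form Omega w'.1 ->
    is_tensor2 Omega w'.2 -> measurable_tensor2 Omega w'.2 ->
    H1form_norm_sq (g := g) dv Omega w' = (I (tensor2_norm_sq w'.2) + I (form_norm_sq w'.1))%E.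
  move=> ? ? ? ?; apply: integral_OmegaD => //; try exact: tensor2_norm_sq_ge0;
    try exact: form_norm_sq_ge0.
    exact: tensor2_norm_sq_measurable.
  exact: form_norm_sq_measurable.
have nsqZ c : H1form_norm_sq dv Omega (c *: w) = ((c ^+ 2)%:E * H1form_norm_sq dv Omega w)%E.
  rewrite /H1form_norm_sq -integral_OmegaZ ?sqr_ge0//.
  - apply: integral_Omega_ext => p _.
    by rewrite mulrDr -tensor2_norm_sqZ -form_norm_sqZ.
  - by move=> p; rewrite addr_ge0 ?form_norm_sq_ge0 ?tensor2_norm_sq_ge0.
  - exact: measurable_funD.
have [Wz|Wn0] := eqVneq (I (form_norm_sq w.1)) 0%E; first by rewrite Wz mule0.
have nw : H1form_norm_sq dv Omega w <> 0%E.
  rewrite nsqE// => /eqP; rewrite padde_eq0// => /andP[_].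
  by rewrite (negbTE Wn0).
have eta_le : (rough_neumann_eigenvalue g dv Omega 1 <=
    I (tensor2_norm_sq w.2) / I (form_norm_sq w.1))%E.
  apply: (minmax1_le _ nsqZ numZ denZ Hw nw) => w'.
  by apply: integral_Omega_ge0 => p; exact: form_norm_sq_ge0.
move: W0 Wn0 eta_le; case: (I (form_norm_sq w.1)) => [r| |]// r0 rn0.
  rewrite eqe in rn0.
  by rewrite inver (negbTE rn0) lee_pdivlMr// lt_def rn0 -lee_fin.
rewrite invey mule0 => eta0.
apply: le_trans T0; apply: mule_le0_ge0 => //.
Qed.

Hypothesis (k : R) (k0 : 0 < k) (Rick : ricci_ge g k).
Local Notation num u := (I (fun p => (tensor2_norm_sq u.2 p + ricci_sharp u.1.2 p)%R)).
Local Notation den u := (I (fun p => ((u.1.1 p) ^+ 2)%R)).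

Lemma ricci_sharp_ge (w : field1 g) p : k * form_norm_sq w p <= ricci_sharp w p.
Proof. by apply: Rick; exact: dom_chart_at. Qed.

Lemma energy_ge u : H2 u ->
  (I (tensor2_norm_sq u.2) + k%:E * I (form_norm_sq u.1.2) <= num u)%E.
Proof.
move=> [[u1 u2 u3 u4 u5] _].
have mW := form_norm_sq_measurable oO u2 u3.
have mT := tensor2_norm_sq_measurable oO u4 u5.
have kW0 p : 0 <= k * form_norm_sq u.1.2 p.
  by rewrite mulr_ge0 ?form_norm_sq_ge0 ?ltW.
rewrite -integral_OmegaZ//; [|exact: ltW|exact: form_norm_sq_ge0].
rewrite -integral_OmegaD//; [|exact: tensor2_norm_sq_ge0|].
  apply: integral_Omega_le => p; first by rewrite addr_ge0 ?tensor2_norm_sq_ge0.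
  by move=> _; rewrite lerD2l ricci_sharp_ge.
by apply: measurable_funM => //; exact: measurable_cst.
Qed.

Lemma energy_ge0 u : (0 <= num u)%E.
Proof.
apply: integral_Omega_ge0 => p; rewrite addr_ge0 ?tensor2_norm_sq_ge0//.
by apply: le_trans (ricci_sharp_ge _ _); rewrite mulr_ge0 ?form_norm_sq_ge0 ?ltW.
Qed.

(** [eta_1] controls the Hessian term because [du] is a competitor for it; the Ricci
    bound controls the curvature term. *)
Lemma energy_ge_rough u : H2 u ->
  ((rough_neumann_eigenvalue g dv Omega 1 + k%:E) * I (form_norm_sq u.1.2) <= num u)%E.
Proof.
move=> Hu; apply: le_trans (energy_ge Hu).
rewrite ge0_muleDl; [|exact: rough_eigenvalue_ge0|by rewrite lee_fin ltW].
rewrite leeD2r//; exact: (rough_eigenvalue_le (sobolev_H2_H1form Hu)).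
Qed.

Lemma H2_norm_sqE u : H2 u -> N2 u =
  (I (tensor2_norm_sq u.2) + I (form_norm_sq u.1.2) + den u)%E.
Proof.
move=> [[u1 u2 u3 u4 u5] _].
have mW := form_norm_sq_measurable oO u2 u3.
have mT := tensor2_norm_sq_measurable oO u4 u5.
rewrite -integral_OmegaD//; try exact: tensor2_norm_sq_ge0; try exact: form_norm_sq_ge0.
rewrite -integral_OmegaD//.
- by move=> p; rewrite addr_ge0 ?tensor2_norm_sq_ge0 ?form_norm_sq_ge0.
- by move=> p; exact: sqr_ge0.
- exact: measurable_funD.
- exact: measurable_funX.
Qed.

(** Uniqueness of weak derivatives would exclude such a [u].  Its energy dominates
    the derivative components, one of which is not null, and [x / 0 = +oo] for
    [x > 0]. *)
Lemma quotient_infinite u : H2 u -> N2 u <> 0%E -> den u = 0%E ->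
  (num u / den u = +oo)%E.
Proof.
move=> Hu Nu Du; rewrite Du inve0 gt0_muley// lt_def energy_ge0 andbT.
apply/eqP => num0; apply: Nu; rewrite H2_norm_sqE// Du adde0.
have := energy_ge Hu; rewrite num0 => le0.
have W0 := integral_Omega_ge0 dv Omega (form_norm_sq_ge0 u.1.2).
have T0 := integral_Omega_ge0 dv Omega (tensor2_norm_sq_ge0 u.2).
have kW0 : (0 <= k%:E * I (form_norm_sq u.1.2))%E by rewrite mule_ge0// lee_fin ltW.
have : (I (tensor2_norm_sq u.2) + k%:E * I (form_norm_sq u.1.2) == 0)%E.
  by rewrite eq_le le0 adde_ge0.
rewrite padde_eq0// mule_eq0 eqe (gt_eqF k0) /= => /andP[/eqP -> /eqP ->].
by rewrite adde0.
Qed.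

(** A basis [b] of a trial space of [H^2] gives the family of its [H^1] parts.
    Either some nonnull combination has a vanishing function component, and the
    maximum is infinite, or the family is independent and [energy_ge_rough] compares
    the quotients of each combination. *)
Lemma biharmonic_ge j : (0 < j)%N ->
  ((rough_neumann_eigenvalue g dv Omega 1 + k%:E) * neumann_eigenvalue g dv Omega j
   <= biharmonic_neumann_eigenvalue g dv Omega j)%E.
Proof.
move=> j0; apply: le_ereal_inf_tmp => _ [b [Hb indep] <-].
set eta := rough_neumann_eigenvalue g dv Omega 1.
set S := ereal_sup _.
have D0 (u : H2_space g) : (0 <= den u)%E.
  by apply: integral_Omega_ge0 => p; exact: sqr_ge0.
have S0 : (0 <= S)%E by apply: span_sup_ge0 => // u; exact: energy_ge0.
have Hspan (c : 'I_j -> R) : H2 (\sum_i c i *: b i) by exact: sobolev_H2_span.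
have eta0 : (0 <= eta + k%:E)%E.
  by rewrite adde_ge0 ?rough_eigenvalue_ge0 ?lee_fin ?ltW.
have quotS (u : H2_space g) : (exists c : 'I_j -> R, u = \sum_i c i *: b i) -> N2 u <> 0%E ->
    (num u / den u <= S)%E.
  by move=> uc Nu; apply: ereal_sup_ubound; exists u.
have [[u [uc Nu Du]]|nD] := pselect (exists u : H2_space g,
    [/\ exists c : 'I_j -> R, u = \sum_i c i *: b i, N2 u <> 0%E &
        den u = 0%E]).
  have Hu : H2 u by case: uc => c ->.
  by have := quotS u uc Nu; rewrite quotient_infinite// leye_eq => /eqP ->; rewrite leey.
have sumE (c : 'I_j -> R) : (\sum_i c i *: b i).1 = \sum_i c i *: (b i).1.
  by apply: (big_morph fst).
apply: (@le_trans _ _ ((eta + k%:E) * ereal_sup [set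
    (I (form_norm_sq z.2) / I (fun p => ((z.1 p) ^+ 2)%R))%E | z in [set z : H1_space g |
    (exists c : 'I_j -> R, z = (\sum_i c i *: (b i).1)%R) /\ H1_norm_sq dv Omega z <> 0%E]])%E).
  apply: lee_wpmul2l => //; apply: ge_ereal_inf; eexists; last exact: lexx.
  exists (fun i => (b i).1); last reflexivity.
  split; first by move=> i; exact: (sobolev_H2_H1 (Hb i)).
  move=> c; rewrite -sumE => N1; apply: indep; apply: contrapT => Nu.
  apply: nD; exists (\sum_i c i *: b i); split; [by exists c | exact: Nu |].
  apply/eqP; rewrite eq_le D0 andbT -N1; apply: integral_Omega_le => p.
    exact: sqr_ge0.
  by move=> _; rewrite lerDr form_norm_sq_ge0.
apply: (ereal_sup_mul_le eta0 S0) => _ [_ [[c ->] +] <-]; rewrite -sumE.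
set u := \sum_i c i *: b i => N1.
have Nu : N2 u <> 0%E.
  move=> N0; apply: N1; apply/eqP; rewrite eq_le H1_norm_sq_ge0 andbT -N0.
  exact: H1_norm_sq_le.
have uc : exists c : 'I_j -> R, u = \sum_i c i *: b i by exists c.
apply: le_trans (quotS u uc Nu); rewrite muleA.
by apply: lee_wpmul2r; [rewrite inve_ge0 | exact: (energy_ge_rough (Hspan c))].
Qed.

End sobolev_spaces.

Unset Implicit Arguments.

Theorem theorem4p3 (R : realType) (n : nat) (M : ptopologicalType)
    (g : riemannian R n M) (dv : {measure set (borel M) -> \bar R})
    (K : R) (Omega : set M)
    (hdv : is_riemannian_volume g dv)
    (hcomplete : riemannian_complete g)
    (hRic : ricci_ge g ((n%:R - 1) * K))
    (hK : 0 < (n%:R - 1) * K)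
    (hopen : open Omega) (hconn : connected Omega)
    (hbdd : riemannian_bounded g Omega)
    (hC1 : C1_boundary g Omega)
    (j : nat) (hj : (0 < j)%N) :
  ((rough_neumann_eigenvalue g dv Omega 1 + ((n%:R - 1) * K)%:E)
     * neumann_eigenvalue g dv Omega j
   <= biharmonic_neumann_eigenvalue g dv Omega j)%E.
Proof.
exact: biharmonic_ge.
Qed.
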